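(* Let $X$ be a separable Banach space which is not quasireflexive. Then for every countable ordinal $\alpha$ there exists a linear (not necessarily closed) subspace $\Gamma \subset X^{*}$ such that $\Gamma_{(\alpha)} \neq \Gamma_{(\alpha+1)} = X^{*}$.
   Context: A Banach space $X$ is quasireflexive if $\dim(X^{**}/\pi(X))<\infty$, where $\pi: X\to X^{**}$ is the canonical embedding. For a subset $\Gamma\subset X^*$, the weak$^*$-derived set $\Gamma_{(1)}$ is the set of all limits of weak$^*$-convergent sequences of elements of $\Gamma$. Weak$^*$-derived sets of arbitrary ordinal order are defined inductively by $\Gamma_{(0)}=\Gamma$ and $\Gamma_{(\alpha)}=\bigcup_{\beta<\alpha}(\Gamma_{(\beta)})_{(1)}$ for $\alpha\ge 1$. *)

(* Defs.v *)
From HB Require Import structures.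
From mathcomp Require Import all_boot all_order all_algebra.
From mathcomp Require Import all_classical all_reals all_analysis.
Set Implicit Arguments. Unset Strict Implicit. Unset Printing Implicit Defensive.
Import Order.TTheory GRing.Theory Num.Theory.
Import numFieldNormedType.Exports.
Local Open Scope classical_set_scope.
Local Open Scope ring_scope.

Section Dual.
Variables (R : realType) (X : normedModType R).

Definition is_dual (f : X -> R) : Prop :=
  (forall (a : R) (u v : X), f (a *: u + v) = a * f u + f v) /\ continuous f.

Definition dual_norm (f : X -> R) : R :=
  sup [set `|f x| | x in [set x : X | `|x| <= 1]].

(* Elements of the bidual X^** : linear functionals on X^* bounded
   for the operator norm (i.e. norm-continuous). Only their values on
   X^* are relevant. *)
Definition is_bidual (phi : (X -> R) -> R) : Prop :=
  (forall (a : R) (f g : X -> R), is_dual f -> is_dual g ->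
     phi (fun x => a * f x + g x) = a * phi f + phi g) /\
  (exists C : R, forall f, is_dual f -> `|phi f| <= C * dual_norm f).

Definition canon (x : X) : (X -> R) -> R := fun f => f x.

(* Quasireflexivity: X^**/pi(X) is finite dimensional, i.e. spanned by the
   classes of finitely many elements psi_0, ..., psi_(n-1) of X^**. *)
Definition quasireflexive : Prop :=
  exists (n : nat) (psi : 'I_n -> (X -> R) -> R),
    (forall i, is_bidual (psi i)) /\
    forall phi, is_bidual phi ->
      exists (x : X) (c : 'I_n -> R),
        forall f, is_dual f -> phi f = canon x f + \sum_(i < n) c i * psi i f.

Definition separable : Prop :=
  exists u : nat -> X, dense (range u).

Definition dual_subspace (G : set (X -> R)) : Prop :=
  (forall f, G f -> is_dual f) /\ G (fun _ => 0) /\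
  (forall (a : R) f g, G f -> G g -> G (fun x => a * f x + g x)).

Definition wstar_derived (G : set (X -> R)) : set (X -> R) :=
  [set f | is_dual f /\ exists g : nat -> X -> R,
     (forall n, G (g n)) /\ forall x, g n x @[n --> \oo] --> f x].

End Dual.

(* Countable ordinals as Brouwer trees: zero, successor, and the (strict)
   supremum  lim f = sup_n (f n + 1)  of a sequence. Every Brouwer tree
   denotes a countable ordinal and every countable ordinal is denoted. *)
Inductive cord : Type :=
| OZero : cord
| OSucc : cord -> cord
| OLim : (nat -> cord) -> cord.

(* Transfinite weak^*-derived sets G_(alpha):
   G_(0) = G,  G_(alpha+1) = (G_(alpha))_(1),
   G_(lim f) = \bigcup_n (G_(f n))_(1)   (= \bigcup_{beta < lim f} (G_(beta))_(1)
   since beta |-> G_(beta) is increasing). *)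
Fixpoint wstar_derived_ord (R : realType) (X : normedModType R)
    (G : set (X -> R)) (a : cord) : set (X -> R) :=
  match a with
  | OZero => G
  | OSucc b => wstar_derived (wstar_derived_ord G b)
  | OLim f => \bigcup_(n in setT) wstar_derived (wstar_derived_ord G (f n))
  end.

(* Main.v *)
Require Import Defs.
From HB Require Import structures.
From mathcomp Require Import all_boot all_order all_algebra.
From mathcomp Require Import all_classical all_reals all_analysis.
From mathcomp Require Import ring lra.
Import Order.TTheory GRing.Theory Num.Theory.
Import numFieldNormedType.Exports.
Set Implicit Arguments. Unset Strict Implicit. Unset Printing Implicit Defensive.
Local Open Scope classical_set_scope.
Local Open Scope ring_scope.

(** Since X is not quasireflexive there are functionals F_k in X^** that are
    uniformly independent modulo X: the k-th coefficient of a combination is at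
    most C_k times its distance to X.  By a form of local reflexivity they are
    approximated, stage after stage, by vectors y_(m,k) of X; the increments
    x_(k,i) of these approximations have partial sums bounded for each k,
    admit bounded biorthogonal functionals u_(k,i) that are weak^*-null as
    i -> oo, and the functionals vanishing on almost all x_(k,i) are weak^*
    sequentially dense in X^*.

    Given alpha, index the families by the nodes of a well-founded tree of rank
    alpha.  A node t carries a vector X_t and a small c_t > 0; its m-th child
    carries X_t - c_t s_m, where s_m is the m-th partial sum of the family of
    t.  Gamma is cut out by the conditions g(X_t) = c_t lim g(s_m) at the leaves.
    By induction on the rank, |g(X_t)| <= c_t (sup |s_m|) |g| whenever g lies in
    the derived set of order the rank of t: the children have
    |g(X_t - c_t s_m)| = O(c_m) with c_m -> 0.  At the root this is a genuine
    restriction.  Conversely, changing g by a far u_(t,i) enforces the condition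
    at t without changing the weak^* limit, so that one extra derivation per
    level of the tree recovers all of X^*. *)

(** * The Hahn-Banach theorem *)

(** The limit of g(s_m) is not weak^* sequentially continuous in g: it equals 1 on every u_(t,i),
    although these are weak^* null. So the leaf equations are lost under derivation and only an
    inequality can be carried along. A bare inequality is not enough either, because the functionals
    converging to g may have norms far above |g|, and at a single vector they only transmit a bound
    with their own constant C. The children repair this: at X_t - c_t s_m the transmitted bound is C
    times a quantity tending to 0 with m. Hence g(X_t) is c_t g(s_m) up to a vanishing error, and
    the estimate holds again with |g| itself, whatever C was. Each node has a family of its own, so
    that its condition can be repaired without disturbing those of unrelated nodes. As soon as alpha
    > 0 the tree has infinitely many nodes; this is what calls for infinitely many independent
    classes of X^**/X. *)

Section HahnBanach.
Variables (R : realType) (V : lmodType R).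

Definition scalar_linear (f : V -> R) : Prop :=
  forall a u v, f (a *: u + v) = a * f u + f v.

Definition linear_subspace (M : set V) : Prop :=
  M 0 /\ forall a u v, M u -> M v -> M (a *: u + v).

Definition linear_relation (G : V -> R -> Prop) : Prop :=
  G 0 0 /\ forall a u r v s, G u r -> G v s -> G (a *: u + v) (a * r + s).

(** Relative to [M] because of the bidual: its elements are maps on all of X -> R of which only the
    values on bounded functionals count, so its norm is only a seminorm, and only on the subspace
    [is_bidual]. *)
Definition seminorm_on (M : set V) (p : V -> R) : Prop :=
  (forall u v, M u -> M v -> p (u + v) <= p u + p v) /\
  (forall a u, M u -> p (a *: u) = `|a| * p u).

Lemma seminorm_ge0 M p u : linear_subspace M -> seminorm_on M p -> M u ->
  0 <= p u.
Proof.
move=> [M0 Ml] [pD pZ] Mu.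
have p0 : p 0 = 0 by rewrite -(scale0r 0) pZ// normr0 mul0r.
have MN : M (-1 *: u) by rewrite -[_ *: _]addr0; exact: Ml.
have := pD _ _ Mu MN; rewrite pZ// normrN1 mul1r scaleN1r subrr p0; lra.
Qed.

Section Extension.
Variables (M : set V) (p : V -> R) (G : V -> R -> Prop).
Hypotheses (subM : linear_subspace M) (semp : seminorm_on M p).
Hypotheses (linG : linear_relation G).
Hypotheses (domG : forall v r, G v r -> M v /\ `|r| <= p v).

Let good (A : set (V * R)) : Prop :=
  linear_relation (fun v r => A (v, r)) /\
  (forall v r, A (v, r) -> M v /\ `|r| <= p v) /\
  (forall v r, G v r -> A (v, r)).

Let MD u v : M u -> M v -> M (u + v).
Proof. by move=> Mu Mv; rewrite -(scale1r u); apply: subM.2. Qed.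

Let MZ a u : M u -> M (a *: u).
Proof. by move=> Mu; rewrite -[_ *: _]addr0; apply: subM.2 => //; exact: subM.1. Qed.

Let AZ A a v r : good A -> A (v, r) -> A (a *: v, a * r).
Proof.
move=> [[A0 Al] _] Avr; have := Al a _ _ _ _ Avr A0.
by rewrite !addr0.
Qed.

Let exists_value A v : good A -> M v ->
  exists c, forall w r, A (w, r) -> `|r + c| <= p (w + v).
Proof.
move=> gA Mv; have [[A0 Al] [AM AG]] := gA.
pose S := [set s | exists w r, A (w, r) /\ s = - p (w + v) - r].
have ub w r : A (w, r) -> ubound S (p (w + v) - r).
  move=> Aw _ [w' [r' [Aw' ->]]].
  have := Al (-1) _ _ _ _ Aw' Aw; rewrite scaleN1r mulN1r => Aww'.
  have [_ /ler_normlW] := AM _ _ Aww'.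
  have -> : - w' + w = -1 *: (w' + v) + (w + v).
    by rewrite scaleN1r opprD addrACA addNr addr0.
  have Mw' := MD (AM _ _ Aw').1 Mv; have Mw := MD (AM _ _ Aw).1 Mv.
  move=> /le_trans/(_ (semp.1 _ _ (MZ (-1) Mw') Mw)).
  rewrite semp.2// normrN1 mul1r => ?; lra.
have Sw w r : A (w, r) -> S (- p (w + v) - r) by move=> ?; exists w, r.
have hS : has_sup S.
  by split; [exists (- p (0 + v) - 0); exact: Sw | exists (p (0 + v) - 0); exact: ub].
exists (sup S) => w r Awr; rewrite ler_norml; apply/andP; split.
- by have := sup_upper_bound hS (Sw _ _ Awr); lra.
- by have := ge_sup hS.1 (ub _ _ Awr); lra.
Qed.

Let extend A v : good A -> M v -> (forall r, ~ A (v, r)) ->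
  exists B, A `<` B /\ good B.
Proof.
move=> gA Mv nA; have [c cP] := exists_value gA Mv.
have [[A0 Al] [AM AG]] := gA.
pose B := [set z : V * R | exists w r t, A (w, r) /\ z = (w + t *: v, r + t * c)].
have AB : A `<=` B.
  by move=> [w r] Aw; exists w, r, 0; rewrite scale0r mul0r !addr0.
exists B; split.
  split=> //; apply: contra_not (nA c); apply.
  by exists 0, 0, 1; rewrite scale1r mul1r !add0r.
split; [split|split].
- exact: AB.
- move=> a _ _ _ _ [w [r [t [Aw [-> ->]]]]] [w' [r' [t' [Aw' [-> ->]]]]].
  exists (a *: w + w'), (a * r + r'), (a * t + t'); split; first exact: Al.
  congr pair; last by ring.
  by rewrite scalerDr scalerDl scalerA addrACA.
- move=> _ _ [w [r [t [Aw [-> ->]]]]]; have Mw := (AM _ _ Aw).1.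
  split; first by apply: MD => //; exact: MZ.
  have [->|t0] := eqVneq t 0.
    by rewrite scale0r mul0r !addr0; exact: (AM _ _ Aw).2.
  have -> : w + t *: v = t *: (t^-1 *: w + v).
    by rewrite scalerDr scalerA divff// scale1r.
  have -> : r + t * c = t * (t^-1 * r + c) by field.
  rewrite semp.2; last by apply: MD => //; exact: MZ.
  rewrite normrM ler_wpM2l//; apply: cP.
  exact: AZ.
- by move=> u r /AG/AB.
Qed.

(** Partial functionals are represented by their graphs. The bound by [p], which vanishes at 0,
    makes a linear graph single-valued, so well-definedness never has to be checked by hand. *)
Lemma hahn_banach : exists f : V -> R,
  (forall a u v, M u -> M v -> f (a *: u + v) = a * f u + f v) /\
  (forall u, M u -> `|f u| <= p u) /\ (forall v r, G v r -> f v = r).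
Proof.
pose GA := [set z : V * R | G z.1 z.2].
have gG : good GA by split=> //; split.
have [F FP Ftot|A [PA Amax]] :=
    @Zorn_bigcup _ [set A : set (V * R) | A = set0 \/ good A].
  have [F0|] := pselect (forall X, F X -> X = set0).
    by left; rewrite -subset0 => z [X FX]; rewrite (F0 _ FX).
  move=> /existsNP[X0 /not_implyP[FX0 X00]]; right.
  have gX X : F X -> X !=set0 -> good X.
    by move=> FX [z Xz]; have [X0'|//] := FP _ FX; rewrite X0' in Xz.
  have gX0 : good X0 by apply: gX => //; apply/set0P/eqP.
  split; [split|split].
  - by exists X0 => //; exact: gX0.1.1.
  - move=> a u r v s [X FX Xu] [Y FY Yv].
    have [XY|YX] := Ftot _ _ FX FY.
    + by exists Y => //; apply: (gX _ FY _).1.2 => //; [exists (v, s) | exact: XY].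
    + by exists X => //; apply: (gX _ FX _).1.2 => //; [exists (u, r) | exact: YX].
  - by move=> v r [X FX Xv]; apply: (gX _ FX _).2.1 => //; exists (v, r).
  - by move=> v r Gv; exists X0 => //; exact: gX0.2.2.
have gA : good A.
  case: PA => // A0; exfalso; apply: (Amax GA); last by right.
  rewrite A0; split; first exact: sub0set.
  by move=> /(_ (0, 0)) /=; apply; exact: linG.1.
have tot v : M v -> exists r, A (v, r).
  move=> Mv; apply: contrapT => /forallNP nA.
  have [B [AB gB]] := extend gA Mv nA.
  by apply: (Amax B AB); right.
have uniq v r s : A (v, r) -> A (v, s) -> r = s.
  move=> Ar As; have := gA.1.2 (-1) _ _ _ _ Ar As.
  rewrite scaleN1r mulN1r addNr => /gA.2.1[M0].
  rewrite -(scale0r v) semp.2; last exact: (gA.2.1 _ _ Ar).1.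
  rewrite normr0 mul0r normr_le0.
  by rewrite addrC subr_eq0 => /eqP.
pose f v := xget 0 [set r | A (v, r)].
have fA v : M v -> A (v, f v).
  by move=> /tot[r Ar]; exact: (@xgetPex _ 0 [set r | A (v, r)] (ex_intro _ r Ar)).
exists f; split; [|split].
- move=> a u v Mu Mv; apply: uniq (fA _ (subM.2 _ _ _ Mu Mv)) _.
  by apply: gA.1.2; exact: fA.
- by move=> u /fA/gA.2.1[].
- move=> v r Gv; have Av := gA.2.2 _ _ Gv.
  exact: uniq (fA _ (gA.2.1 _ _ Av).1) Av.
Qed.

End Extension.
End HahnBanach.

Section ScalarLinear.
Variables (R : realType) (V : lmodType R).
Implicit Types f : V -> R.

Lemma slin0 f : scalar_linear f -> f 0 = 0.
Proof. by move=> /(_ (-1) 0 0); rewrite scaler0 addr0 mulN1r addNr. Qed.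

Lemma slinD f u v : scalar_linear f -> f (u + v) = f u + f v.
Proof. by move=> fl; rewrite -{1}(scale1r u) fl mul1r. Qed.

Lemma slinZ f a u : scalar_linear f -> f (a *: u) = a * f u.
Proof. by move=> fl; rewrite -[a *: u]addr0 fl (slin0 fl) addr0. Qed.

Lemma slinN f u : scalar_linear f -> f (- u) = - f u.
Proof. by move=> fl; rewrite -scaleN1r (slinZ _ _ fl) mulN1r. Qed.

Lemma slinB f u v : scalar_linear f -> f (u - v) = f u - f v.
Proof. by move=> fl; rewrite (slinD _ _ fl) (slinN _ fl). Qed.

Lemma slin_sum f (I : Type) (r : seq I) (P : pred I) (F : I -> V) :
  scalar_linear f -> f (\sum_(i <- r | P i) F i) = \sum_(i <- r | P i) f (F i).
Proof.
move=> fl; apply: (big_morph f _ (slin0 fl)) => u v; exact: slinD.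
Qed.

End ScalarLinear.

(** * Bounded functionals: extension and pointwise limits *)

Section Dual.
Variables (R : realType) (X : normedModType R).
Implicit Types (f g : X -> R) (B C : R).

Definition bounded_by B f : Prop := forall x, `|f x| <= B * `|x|.

Let pack_linear f (lf : scalar_linear f) : {linear X -> R^o} :=
  HB.pack (f : X -> R^o) (GRing.isLinear.Build _ _ _ _ (f : X -> R^o) lf).

Lemma is_dualP f :
  is_dual f <-> scalar_linear f /\ exists2 B, 0 <= B & bounded_by B f.
Proof.
split=> [[fl fc]|[fl [B B0 fB]]]; split=> //.
- have /linear_bounded_continuous/linear_boundedP : continuous (pack_linear fl) by [].
  move=> [B [_ BP]]; exists (`|B| + 1); first by rewrite addr_ge0.
  by apply: BP; rewrite (le_lt_trans (ler_norm _))// ltrDl.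
- suff : continuous (pack_linear fl) by [].
  apply/linear_bounded_continuous/linear_boundedP.
  exists B; split; first exact: num_real.
  by move=> C BC x; rewrite (le_trans (fB x))// ler_wpM2r// ltW.
Qed.

Lemma is_dual_slin f : is_dual f -> scalar_linear f.
Proof. by case. Qed.

Lemma bounded_by_le B C f : B <= C -> bounded_by B f -> bounded_by C f.
Proof. by move=> BC fB x; rewrite (le_trans (fB x))// ler_wpM2r. Qed.

Lemma is_dual_bound f : is_dual f -> exists2 B, 0 < B & bounded_by B f.
Proof.
move=> /is_dualP[_ [B B0 fB]]; exists (B + 1); first by rewrite ltr_wpDl.
by apply: bounded_by_le fB; rewrite lerDl.
Qed.

Lemma bounded_byD a B C f g : bounded_by B f -> bounded_by C g ->
  bounded_by (`|a| * B + C) (fun x => a * f x + g x).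
Proof.
move=> fB gC x; rewrite (le_trans (ler_normD _ _))// mulrDl lerD//.
by rewrite normrM -mulrA ler_wpM2l.
Qed.

Lemma is_dual0 : @is_dual R X (fun=> 0).
Proof.
apply/is_dualP; split; first by move=> a u v; rewrite mulr0 addr0.
by exists 0 => // x; rewrite normr0 mul0r.
Qed.

Lemma is_dual_comb a f g : is_dual f -> is_dual g ->
  is_dual (fun x => a * f x + g x).
Proof.
move=> /is_dualP[fl [B B0 fB]] /is_dualP[gl [C C0 gC]]; apply/is_dualP; split.
  by move=> b u v; rewrite fl gl; ring.
by exists (`|a| * B + C); [rewrite addr_ge0// mulr_ge0 | exact: bounded_byD].
Qed.

Lemma dual_extension C (G : X -> R -> Prop) : 0 <= C -> linear_relation G ->
  (forall v r, G v r -> `|r| <= C * `|v|) ->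
  exists f, [/\ is_dual f, bounded_by C f & forall v r, G v r -> f v = r].
Proof.
move=> C0 linG GC.
have [||//||f [fl [fC fG]]] := @hahn_banach R X setT (fun v => C * `|v|) G.
- by split.
- split=> [u v _ _|a u _]; first by rewrite -mulrDr ler_wpM2l// ler_normD.
  by rewrite normrZ mulrCA.
- by move=> v r Gv; split=> //; exact: GC.
have fC' : bounded_by C f by move=> x; exact: fC.
exists f; split=> //; apply/is_dualP; split; last by exists C.
by move=> a u v; exact: fl.
Qed.

Lemma norming_functional (x : X) :
  exists f, [/\ is_dual f, bounded_by 1 f & f x = `|x|].
Proof.
pose G v r := exists t, v = t *: x /\ r = t * `|x|.
have linG : linear_relation G.
  split; first by exists 0; rewrite scale0r mul0r.
  move=> a _ _ _ _ [t [-> ->]] [s [-> ->]]; exists (a * t + s).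
  by rewrite scalerDl scalerA; split=> //; ring.
have G1 v r : G v r -> `|r| <= 1 * `|v|.
  by move=> [t [-> ->]]; rewrite normrM normr_id mul1r normrZ.
have [f [df f1 fx]] := dual_extension ler01 linG G1.
exists f; split=> //; apply: fx; exists 1; by rewrite scale1r mul1r.
Qed.

Lemma dense_approx (A : set X) (x : X) e : dense A -> 0 < e ->
  exists2 a, A a & `|x - a| < e.
Proof.
move=> dA e0; have [||a [xa Aa]] := dA (ball x e).
- by exists x; exact: ballxx.
- exact: ball_open.
by exists a => //; move: xa; rewrite -ball_normE.
Qed.

(** Equicontinuity extends the convergence from a dense set to X. The weak^* limits required of the
    biorthogonal system are obtained in this way. *)
Lemma bounded_dense_cvg (h : nat -> X -> R) f B (A : set X) :
  dense A -> 0 <= B -> (forall n, is_dual (h n)) -> is_dual f ->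
  (forall n, bounded_by B (h n)) ->
  (forall a, A a -> \forall n \near \oo, h n a = f a) ->
  forall x, h n x @[n --> \oo] --> f x.
Proof.
move=> dA B0 dh df hB hA x; have [C C0 fC] := is_dual_bound df.
apply/cvgrPdist_lt => e e0.
have d0 : 0 < e / (B + C) by rewrite divr_gt0// ltr_wpDl.
have [a Aa xa] := dense_approx x dA d0.
near=> n.
have -> : f x - h n x = f (x - a) - h n (x - a).
  rewrite (slinB _ _ (is_dual_slin df)) (slinB _ _ (is_dual_slin (dh n))).
  by rewrite (_ : h n a = f a); [ring | near: n; exact: hA].
rewrite (le_lt_trans (ler_normB _ _))//.
rewrite (le_lt_trans (lerD (fC _) (hB _ _)))//.
by move: xa; rewrite ltr_pdivlMr ?ltr_wpDl// -mulrDl mulrC (addrC C).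
Unshelve. all: by end_near. Qed.

End Dual.

(** * Boundedness of weak^* convergent sequences *)

Section UniformBoundedness.
Variables (R : realType) (X : completeNormedModType R).

Lemma pointwise_cvg_bounded (h : nat -> X -> R) (f : X -> R) :
  (forall n, is_dual (h n)) -> (forall x, h n x @[n --> \oo] --> f x) ->
  exists2 B, 0 < B & forall n, bounded_by B (h n).
Proof.
move=> dh hf.
have /(_ _ _ 1)[||M MP] := @Banach_Steinhauss R X R^o (range h).
- move=> _ [n _ <-]; have [hl [B B0 hB]] := (is_dualP _).1 (dh n); split=> // r.
  exists (B * r) => x xr; rewrite (le_trans (hB x))// ler_wpM2l//.
- move=> x; have [M [_ MP]] := cvg_seq_bounded (cvgP _ (hf x)).
  by exists (`|M| + 1) => _ [n _ <-]; apply: MP => //; rewrite (le_lt_trans (ler_norm _))// ltrDl.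
exists (`|M| + 1); first by rewrite ltr_wpDl.
move=> n x; have [->|x0] := eqVneq x 0.
  by rewrite (slin0 (is_dual_slin (dh n))) !normr0 mulr0.
have nx0 : 0 < `|x| by rewrite normr_gt0.
have hn : h n (`|x|^-1 *: x) = `|x|^-1 * h n x by rewrite (slinZ _ _ (is_dual_slin (dh n))).
have : `|h n (`|x|^-1 *: x)| <= M.
  apply: MP; first by exists n.
  by rewrite normrZ normfV normr_id mulVf ?gt_eqF.
rewrite hn normrM normfV normr_id ler_pdivrMl// mulrC => /le_trans; apply.
by rewrite ler_wpM2r// (le_trans (ler_norm M))// lerDl.
Qed.

End UniformBoundedness.

(** * Finite spans and total boundedness for a seminorm *)

Section Span.
Variables (R : realType) (V : lmodType R).
Implicit Types (s : seq V) (v w : V).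

Fixpoint spanned s : set V :=
  if s is e :: s' then [set v | exists c w, spanned s' w /\ v = c *: e + w]
  else [set 0].

Lemma spanned_linear s : linear_subspace (spanned s).
Proof.
elim: s => [|e s [IH0 IH]] /=.
  by split=> // a u v -> ->; rewrite scaler0 addr0.
split; first by exists 0, 0; rewrite scale0r addr0.
move=> a _ _ [c [w [sw ->]]] [c' [w' [sw' ->]]].
exists (a * c + c'), (a *: w + w'); split; first exact: IH.
by rewrite scalerDr scalerDl scalerA addrACA.
Qed.

Lemma subspaceD (M : set V) u v : linear_subspace M -> M u -> M v -> M (u + v).
Proof. by move=> [_ Ml] Mu Mv; rewrite -(scale1r u); exact: Ml. Qed.

Lemma subspaceZ (M : set V) a u : linear_subspace M -> M u -> M (a *: u).
Proof. by move=> [M0 Ml] Mu; rewrite -[_ *: _]addr0; exact: Ml. Qed.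

Lemma subspaceB (M : set V) u v : linear_subspace M -> M u -> M v -> M (u - v).
Proof.
by move=> subM Mu Mv; apply: subspaceD => //; rewrite -scaleN1r; exact: subspaceZ.
Qed.

Lemma subspace_sum (M : set V) (I : eqType) (r : seq I) (F : I -> V) :
  linear_subspace M -> (forall i, i \in r -> M (F i)) -> M (\sum_(i <- r) F i).
Proof.
move=> subM FM; rewrite big_seq; elim/big_ind: _ => //; first exact: subM.1.
by move=> u v; exact: subspaceD.
Qed.

Lemma mem_spanned s v : v \in s -> spanned s v.
Proof.
elim: s => //= e s IH; rewrite inE => /orP[/eqP ->|/IH sv].
  by exists 1, 0; rewrite scale1r addr0; split=> //; exact: (spanned_linear s).1.
by exists 0, v; rewrite scale0r add0r.
Qed.

Lemma spanned_sub (M : set V) s : linear_subspace M ->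
  (forall v, v \in s -> M v) -> spanned s `<=` M.
Proof.
move=> subM; elim: s => [_ v ->|e s IH sM v [c [w [sw ->]]]]; first exact: subM.1.
apply: subM.2; first by apply: sM; rewrite mem_head.
by apply: IH => // v' v's; apply: sM; rewrite inE v's orbT.
Qed.

Lemma spanned_coord s v : spanned s v ->
  exists c : nat -> R, v = \sum_(i < size s) c i *: s`_i.
Proof.
elim: s v => [v ->|e s IH v [a [w [/IH[c ->] ->]]]] /=.
  by exists (fun=> 0); rewrite big_ord0.
by exists (fun i => if i is j.+1 then c j else a); rewrite big_ord_recl.
Qed.

Section TotallyBounded.
Variables (M : set V) (p : V -> R).
Hypotheses (subM : linear_subspace M) (semp : seminorm_on M p).

Lemma seminorm0 : p 0 = 0.
Proof. by rewrite -(scale0r 0) semp.2 ?normr0 ?mul0r//; exact: subM.1. Qed.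

Lemma seminormB u v : M u -> M v -> p (u - v) <= p u + p v.
Proof.
move=> Mu Mv; have MN : M (- v) by rewrite -scaleN1r; exact: subspaceZ.
rewrite (le_trans (semp.1 _ _ Mu MN))// lerD2l -scaleN1r semp.2//.
by rewrite normrN1 mul1r.
Qed.

Lemma seminorm_sum (I : eqType) (r : seq I) (F : I -> V) :
  (forall i, i \in r -> M (F i)) -> p (\sum_(i <- r) F i) <= \sum_(i <- r) p (F i).
Proof.
elim: r => [|i r IH] FM; first by rewrite !big_nil seminorm0.
have FMr j : j \in r -> M (F j) by move=> jr; apply: FM; rewrite inE jr orbT.
rewrite !big_cons (le_trans (semp.1 _ _ _ _)) ?lerD2l ?IH//.
  by apply: FM; rewrite mem_head.
exact: subspace_sum.
Qed.

Lemma grid (r d : R) : 0 < d -> exists B : seq R,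
  forall c, `|c| <= r -> exists2 b, b \in B & `|c - b| <= d.
Proof.
move=> d0; have [N rN] : exists N : nat, `|r| / d < N%:R.
  by exists (Num.bound (`|r| / d)); rewrite archi_boundP// divr_ge0// ltW.
exists [seq (i%:R - N%:R) * d | i <- iota 0 (N + N).+1] => c cr.
have cd : - N%:R < c / d < N%:R.
  rewrite -ltr_norml normrM normfV (gtr0_norm d0) (le_lt_trans _ rN)//.
  by rewrite ler_pM2r ?invr_gt0// (le_trans cr)// ler_norm.
have t0 : 0 <= c / d + N%:R by have /andP[] := cd; lra.
have /andP[] := truncn_itv t0; set i := Num.truncn _ => i1 i2.
exists ((i%:R - N%:R) * d).
  apply/mapP; exists i => //; rewrite mem_iota /= add0n ltnS -(ler_nat R) natrD.
  by rewrite (le_trans i1)//; have /andP[_] := cd; lra.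
have -> : c - (i%:R - N%:R) * d = (c / d + N%:R - i%:R) * d.
  by field; rewrite gt_eqF.
rewrite normrM (gtr0_norm d0) ler_piMl ?(ltW d0)// ler_norml.
by move: i2; rewrite -natr1 => i2; apply/andP; split; lra.
Qed.

(* When [e] is at distance 0 from the span of [s] no bound on its coefficient
   is available, but each vector is itself arbitrarily close to that span. *)
Lemma spanned_totally_bounded s r d : (forall v, v \in s -> M v) -> 0 < d ->
  exists B : seq V, (forall w, w \in B -> spanned s w) /\
    forall v, spanned s v -> p v <= r -> exists2 w, w \in B & p (v - w) <= d.
Proof.
elim: s r d => [|e s IH] r d sM d0 /=.
  exists [:: 0]; split=> [w|v -> _]; first by rewrite mem_seq1 => /eqP ->.
  by exists 0; rewrite ?mem_head// subr0 seminorm0 ltW.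
have Me : M e by apply: sM; rewrite mem_head.
have sM' v : v \in s -> M v by move=> vs; apply: sM; rewrite inE vs orbT.
have spM := spanned_sub subM sM'.
have d20 : 0 < d / 2 by rewrite divr_gt0.
have [near0|] := pselect (forall eps, 0 < eps ->
    exists2 w, spanned s w & p (e + w) < eps).
  have [B [Bs BP]] := IH (r + d / 2) _ sM' d20; exists B; split.
    by move=> w /Bs sw; exists 0, w; rewrite scale0r add0r.
  move=> _ [c [w [sw ->]]] pr.
  have eps0 : 0 < d / 2 / (`|c| + 1) by rewrite divr_gt0// ltr_wpDl.
  have [w0 sw0 pw0] := near0 _ eps0.
  have Mw := spM _ sw; have Mw0 := spM _ sw0.
  pose v' := w - c *: w0.
  have sv' : spanned s v'.
    by apply: subspaceB (spanned_linear s) sw _; exact: subspaceZ (spanned_linear s) sw0.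
  have eqv : c *: e + w = v' + c *: (e + w0).
    by rewrite /v' scalerDr [c *: e + c *: w0]addrC addrA subrK addrC.
  have pc : p (c *: (e + w0)) <= d / 2.
    rewrite semp.2; last exact: subspaceD.
    rewrite (le_trans (ler_wpM2l _ (ltW pw0)))// mulrA ler_pdivrMr ?ltr_wpDl//.
    by rewrite mulrC ler_pM2l// lerDl.
  have Mc : M (c *: (e + w0)) by apply: subspaceZ => //; exact: subspaceD.
  have Mv' := spM _ sv'.
  have pv' : p v' <= r + d / 2.
    have -> : v' = (c *: e + w) - c *: (e + w0) by rewrite eqv addrK.
    rewrite (le_trans (seminormB _ _))// ?lerD//.
    by apply: subspaceD => //; exact: subspaceZ.
  have [b Bb pb] := BP _ sv' pv'; exists b => //.
  rewrite eqv addrAC (le_trans (semp.1 _ _ _ _))//.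
    by apply: subspaceB => //; exact/spM/Bs.
  by rewrite [leRHS]splitr lerD.
move=> /existsNP[c0 /not_implyP[c00 far]].
have far' w : spanned s w -> c0 <= p (e + w).
  by move=> sw; rewrite leNgt; apply/negP => ?; apply: far; exists w.
have coef_le c w : spanned s w -> p (c *: e + w) <= r -> `|c| <= r / c0.
  move=> sw pr; rewrite ler_pdivlMr// (le_trans _ pr)//.
  have [->|cn0] := eqVneq c 0.
    rewrite normr0 mul0r scale0r add0r; exact: seminorm_ge0 subM semp (spM _ sw).
  have -> : c *: e + w = c *: (e + c^-1 *: w).
    by rewrite scalerDr scalerA divff// scale1r.
  rewrite semp.2; last first.
    by apply: subspaceD => //; apply: subspaceZ => //; exact: spM.
  by rewrite ler_wpM2l// far'//; exact: subspaceZ (spanned_linear s) sw.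
have pe0 : 0 <= p e := seminorm_ge0 subM semp Me.
have [C CP] := @grid (r / c0) (d / 2 / (p e + 1)) (divr_gt0 d20 (ltr_wpDl pe0 ltr01)).
have [B [Bs BP]] := IH (r + r / c0 * p e) _ sM' d20.
exists [seq c *: e + w | c <- C, w <- B]; split.
  by move=> _ /allpairsP[[c w] /= [_ /Bs sw ->]]; exists c, w.
move=> _ [c [w [sw ->]]] pr.
have cr := coef_le _ _ sw pr; have [c' Cc' cc'] := CP _ cr.
have Mw := spM _ sw.
have pw : p w <= r + r / c0 * p e.
  have -> : w = (c *: e + w) - c *: e by rewrite addrC addKr.
  have Mce : M (c *: e) by exact: subspaceZ.
  rewrite (le_trans (seminormB _ Mce))//; first exact: subspaceD.
  by rewrite lerD// semp.2// ler_wpM2r.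
have [b Bb pb] := BP _ sw pw.
exists (c' *: e + b); first by apply/allpairsP; exists (c', b).
have -> : c *: e + w - (c' *: e + b) = (c - c') *: e + (w - b).
  by rewrite scalerBl opprD addrACA.
have Mb := spM _ (Bs _ Bb).
have Mce : M ((c - c') *: e) by exact: subspaceZ.
rewrite (le_trans (semp.1 _ _ Mce _))//; first exact: subspaceB.
rewrite [leRHS]splitr lerD// semp.2//.
rewrite (le_trans (ler_wpM2r pe0 cc'))// mulrAC ler_pdivrMr ?ltr_wpDl//.
by rewrite ler_pM2l// lerDl.
Qed.

End TotallyBounded.
End Span.

(** * The bidual norm *)

Section Bidual.
Variables (R : realType) (X : normedModType R).
Implicit Types (f g : X -> R) (phi psi : (X -> R) -> R).

Local Notation pi := (@Defs.canon R X).

Lemma dual_norm_has_sup f : is_dual f ->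
  has_sup [set `|f x| | x in [set x : X | `|x| <= 1]].
Proof.
move=> /is_dual_bound[B B0 fB]; split.
  by exists `|f 0|, 0 => //=; rewrite normr0.
exists B => _ [x /= x1 <-]; rewrite (le_trans (fB x))//.
by rewrite ger_pMr.
Qed.

Lemma dual_norm_bounded_by f : is_dual f -> bounded_by (dual_norm f) f.
Proof.
move=> df x; have fl := is_dual_slin df.
have [->|x0] := eqVneq x 0; first by rewrite (slin0 fl) !normr0 mulr0.
have nx0 : 0 < `|x| by rewrite normr_gt0.
have : `|f (`|x|^-1 *: x)| <= dual_norm f.
  apply: (sup_upper_bound (dual_norm_has_sup df)); exists (`|x|^-1 *: x) => //=.
  by rewrite normrZ normfV normr_id mulVf ?gt_eqF.
rewrite (slinZ _ _ fl) normrM normfV normr_id ler_pdivrMl// mulrC//.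
Qed.

Lemma dual_norm_le f B : bounded_by B f -> 0 <= B -> dual_norm f <= B.
Proof.
move=> fB B0; apply: ge_sup; first by exists `|f 0|, 0 => //=; rewrite normr0.
by move=> _ [x /= x1 <-]; rewrite (le_trans (fB x))// ler_piMr.
Qed.

Lemma fct_combE a phi psi f : (a *: phi + psi) f = a * phi f + psi f.
Proof. by []. Qed.

Lemma bidual_linear : linear_subspace (@is_bidual R X).
Proof.
split.
  split; first by move=> a f g _ _; rewrite mulr0 addr0.
  by exists 0 => f _; rewrite normr0 mul0r.
move=> a phi psi [phil [C phiC]] [psil [C' psiC]]; split.
  move=> b f g df dg; rewrite !fct_combE phil// psil//; ring.
exists (`|a| * C + C') => f df; rewrite [X in `|X|]/(a * phi f + psi f).
rewrite (le_trans (ler_normD _ _))// mulrDl lerD ?psiC//.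
by rewrite normrM -mulrA ler_wpM2l// phiC.
Qed.

Lemma bidual_comb phi a f g : is_bidual phi -> is_dual f -> is_dual g ->
  phi (fun x => a * f x + g x) = a * phi f + phi g.
Proof. by case=> + _; apply. Qed.

Lemma bidual0 phi : is_bidual phi -> phi (fun=> 0) = 0.
Proof.
move=> bphi; have d0 := @is_dual0 R X; have := bidual_comb (-1) bphi d0 d0.
by rewrite mulr0 addr0 mulN1r addNr.
Qed.

Lemma is_dual_sum (I : Type) (r : seq I) (c : I -> R) (f : I -> X -> R) :
  (forall i, is_dual (f i)) -> is_dual (fun x => \sum_(i <- r) c i * f i x).
Proof.
move=> df; elim: r => [|i r IH].
  by rewrite (_ : (fun _ => _) = fun=> 0);
    [exact: is_dual0 | apply/funext => x; rewrite big_nil].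
rewrite (_ : (fun _ => _) = fun x => c i * f i x + \sum_(j <- r) c j * f j x).
  exact: is_dual_comb.
by apply/funext => x; rewrite big_cons.
Qed.

Lemma bidual_sum phi (I : Type) (r : seq I) (c : I -> R) (f : I -> X -> R) :
  is_bidual phi -> (forall i, is_dual (f i)) ->
  phi (fun x => \sum_(i <- r) c i * f i x) = \sum_(i <- r) c i * phi (f i).
Proof.
move=> bphi df; elim: r => [|i r IH].
  rewrite big_nil -[RHS](bidual0 bphi); congr phi; apply/funext => x.
  by rewrite big_nil.
rewrite big_cons -IH -bidual_comb//; last exact: is_dual_sum.
by congr phi; apply/funext => x; rewrite big_cons.
Qed.

Lemma bidual_canon x : @is_bidual R X (pi x).
Proof.
split=> //; exists `|x| => f df; rewrite mulrC; exact: dual_norm_bounded_by.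
Qed.

Definition dual_ball : set (X -> R) := [set f | is_dual f /\ bounded_by 1 f].

Definition bnorm phi : R := sup [set `|phi f| | f in dual_ball].

Let ball0 : dual_ball (fun=> 0).
Proof. by split; [exact: is_dual0 | move=> x; rewrite normr0 mul1r]. Qed.

Lemma bnorm_has_sup phi : is_bidual phi -> has_sup [set `|phi f| | f in dual_ball].
Proof.
move=> [phil [C phiC]]; split; first by exists `|phi (fun=> 0)|, (fun=> 0).
exists `|C| => _ [f [df f1] <-]; rewrite (le_trans (phiC f df))//.
have fb := dual_norm_le f1 ler01.
have f0 : 0 <= dual_norm f.
  apply: (@le_trans _ _ `|f 0|) => //; apply: (sup_upper_bound (dual_norm_has_sup df)).
  by exists 0 => //=; rewrite normr0.
rewrite (le_trans (ler_wpM2r f0 (ler_norm C)))// ler_piMr//.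
Qed.

Lemma le_bnorm1 phi f : is_bidual phi -> dual_ball f -> `|phi f| <= bnorm phi.
Proof. by move=> /bnorm_has_sup hs bf; apply: sup_upper_bound => //; exists f. Qed.

Lemma bnorm_le phi C : (forall f, dual_ball f -> `|phi f| <= C) -> bnorm phi <= C.
Proof.
move=> phiC; apply: ge_sup; first by exists `|phi (fun=> 0)|, (fun=> 0).
by move=> _ [f bf <-]; exact: phiC.
Qed.

Lemma bnorm_eq phi psi : (forall f, is_dual f -> phi f = psi f) ->
  bnorm phi = bnorm psi.
Proof.
move=> e; congr sup; apply/seteqP; split=> [_ [f bf <-]|_ [f bf <-]];
by exists f; rewrite // e//; case: bf.
Qed.

Lemma le_bnorm phi f B : is_bidual phi -> is_dual f -> bounded_by B f -> 0 <= B ->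
  `|phi f| <= B * bnorm phi.
Proof.
move=> bphi df fB; rewrite le_eqVlt => /predU1P[B0|B0].
  rewrite -B0 mul0r (_ : f = fun=> 0) ?(bidual0 bphi) ?normr0//.
  by apply/funext => x; apply/eqP; rewrite -normr_le0 (le_trans (fB x))// -B0 mul0r.
have d0 := @is_dual0 R X.
have bf : dual_ball (fun x => B^-1 * f x + 0).
  split; first exact: (is_dual_comb _ df d0).
  move=> x; rewrite addr0 normrM normfV (gtr0_norm B0) ler_pdivrMl// mul1r.
  exact: fB.
have := le_bnorm1 bphi bf; rewrite (bidual_comb _ bphi df d0) (bidual0 bphi) addr0.
by rewrite normrM normfV (gtr0_norm B0) ler_pdivrMl.
Qed.

Lemma bnorm_seminorm : seminorm_on (@is_bidual R X) bnorm.
Proof.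
split=> [phi psi bphi bpsi|a phi bphi].
  apply: bnorm_le => f bf; rewrite [X in `|X|]/(phi f + psi f).
  by rewrite (le_trans (ler_normD _ _))// lerD// le_bnorm1.
have le b psi : is_bidual psi -> bnorm (b *: psi) <= `|b| * bnorm psi.
  move=> bpsi; apply: bnorm_le => f bf; rewrite [X in `|X|]/(b * psi f).
  by rewrite normrM ler_wpM2l// le_bnorm1.
apply/eqP; rewrite eq_le le//=.
have [->|a0] := eqVneq a 0.
  rewrite normr0 mul0r (le_trans (normr_ge0 ((0 *: phi : (X -> R) -> R) (fun=> 0))))//.
  by apply: le_bnorm1 => //; exact: subspaceZ bidual_linear bphi.
have ba := subspaceZ a bidual_linear bphi.
rewrite -ler_pdivlMl ?normr_gt0// -normfV (le_trans _ (le a^-1 _ ba))//.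
by rewrite scalerA mulVf// scale1r.
Qed.

Lemma bnorm_canon x : bnorm (pi x) = `|x|.
Proof.
apply/eqP; rewrite eq_le; apply/andP; split.
  by apply: bnorm_le => f [_ f1]; have := f1 x; rewrite mul1r.
have [f [df f1 fx]] := norming_functional x.
by rewrite -[leLHS]normr_id -fx; apply: (le_bnorm1 (bidual_canon x)).
Qed.

Lemma bnorm_ge0 phi : is_bidual phi -> 0 <= bnorm phi.
Proof. exact: seminorm_ge0 bidual_linear bnorm_seminorm. Qed.

Lemma bidualB phi x : is_bidual phi -> is_bidual (phi - pi x).
Proof. by move=> bphi; apply: subspaceB bidual_linear bphi _; exact: bidual_canon. Qed.

(** Take a 1/8-net of the unit ball of the span and, for each net point, a functional attaining its
    norm up to 1/8. On a unit vector, the functional of a net point within 1/8 has absolute value at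
    least 1 - 3/8, more than 1/2. *)
Lemma finite_norming (s : seq ((X -> R) -> R)) :
  (forall phi, phi \in s -> is_bidual phi) ->
  exists A : seq (X -> R), (forall f, f \in A -> dual_ball f) /\
    forall phi, spanned s phi -> forall C : R, (forall f, f \in A -> `|phi f| <= C) ->
      0 <= C -> bnorm phi <= 2 * C.
Proof.
move=> bs; have e0 : 0 < 8^-1 :> R by rewrite invr_gt0.
have [B [Bs BP]] := spanned_totally_bounded bidual_linear bnorm_seminorm 1 bs e0.
have bB w : spanned s w -> is_bidual w by exact: spanned_sub bidual_linear bs _.
have /choice[F FP] (w : (X -> R) -> R) : exists f, is_bidual w ->
    dual_ball f /\ bnorm w - 8^-1 <= `|w f|.
  have [bw|nw] := pselect (is_bidual w); last by exists (fun=> 0).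
  have [_ [f bf <-] wf] := sup_adherent e0 (bnorm_has_sup bw).
  by exists f => _; split=> //; exact: ltW.
exists [seq F w | w <- B]; split.
  by move=> _ /mapP[w /Bs/bB/FP[bf _] ->].
move=> phi sphi C phiC C0; have bphi := bB _ sphi.
have [|phi0] := leP (bnorm phi) 0; first by move=> /le_trans; apply; rewrite mulr_ge0.
pose n := bnorm phi; pose psi := n^-1 *: phi.
have bpsi : is_bidual psi by exact: subspaceZ bidual_linear bphi.
have psi1 : bnorm psi = 1.
  by rewrite bnorm_seminorm.2// gtr0_norm ?invr_gt0// mulVf// gt_eqF.
have [w Bw pw] : exists2 w, w \in B & bnorm (psi - w) <= 8^-1.
  by apply: BP; [exact: subspaceZ (spanned_linear s) sphi | rewrite psi1].
have bw := bB _ (Bs _ Bw); have [bf wf] := FP w bw.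
have bpw : is_bidual (psi - w) by exact: subspaceB bidual_linear bpsi bw.
have w1 : 1 <= bnorm w + 8^-1.
  have := bnorm_seminorm.1 _ _ bw bpw; rewrite addrC subrK psi1 => /le_trans; apply.
  by rewrite lerD.
have pwf : `|psi (F w) - w (F w)| <= 8^-1.
  by apply: le_trans pw; apply: (@le_bnorm1 (psi - w)).
have psif : `|psi (F w)| <= n^-1 * C.
  rewrite [X in `|X|]/(n^-1 * phi (F w)) normrM gtr0_norm ?invr_gt0//.
  by rewrite ler_wpM2l ?invr_ge0 ?(ltW phi0)// phiC//; apply/mapP; exists w.
have wFw : `|w (F w)| <= 8^-1 + n^-1 * C.
  have -> : w (F w) = psi (F w) - (psi (F w) - w (F w)) by ring.
  by rewrite (le_trans (ler_normB _ _))// addrC lerD.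
have : 2^-1 <= n^-1 * C.
  move: wf w1 wFw; set a := `|w _|; set b := n^-1 * C.
  by move: (bnorm w) => c; lra.
by rewrite mulrC ler_pdivlMr// -/n => ?; lra.
Qed.

End Bidual.

(** * Local reflexivity *)

Section Helly.
Variables (R : realType) (X : normedModType R).
Implicit Types (A : seq (X -> R)) (phi : (X -> R) -> R).

Local Notation pi := (@Defs.canon R X).

(** [h] is a combination of functionals of [A], on which [phi] is evaluation at [p]. The induction
    removes one functional at a time instead of naming coefficients. *)
Lemma bidual_eval_kernel A phi (h : X -> R) (p : X) : is_bidual phi ->
  (forall g, g \in A -> is_dual g) -> (forall g, g \in A -> phi g = g p) ->
  is_dual h -> (forall v, (forall g, g \in A -> g v = 0) -> h v = 0) ->
  phi h = h p.
Proof.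
move=> bphi; elim: A h => [|g A IH] h dA phiA dh hA.
  have -> : h = fun=> 0 by apply/funext => v; exact: hA.
  exact: bidual0.
have dA' a : a \in A -> is_dual a by move=> aA; apply: dA; rewrite inE aA orbT.
have phiA' a : a \in A -> phi a = a p by move=> aA; apply: phiA; rewrite inE aA orbT.
have dg : is_dual g by apply: dA; rewrite mem_head.
have [[z [zA gz]]|nz] := pselect (exists z, (forall a, a \in A -> a z = 0) /\ g z != 0).
  pose c := h z / g z.
  have dh' : is_dual (fun x => - c * g x + h x) by exact: is_dual_comb.
  have := IH _ dA' phiA' dh' _; rewrite bidual_comb// phiA ?mem_head// => H.
  apply: (addrI (- c * g p)); apply: H => v vA.
  have : h (v - (g v / g z) *: z) = 0.
    apply: hA => a; rewrite inE => /predU1P[->|aA].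
      by rewrite (slinB _ _ (is_dual_slin dg)) (slinZ _ _ (is_dual_slin dg)) divfK// subrr.
    have la := is_dual_slin (dA' _ aA).
    by rewrite (slinB _ _ la) (slinZ _ _ la) (vA _ aA) (zA _ aA) mulr0 subrr.
  rewrite (slinB _ _ (is_dual_slin dh)) (slinZ _ _ (is_dual_slin dh)) => <-.
  by rewrite /c; field.
apply: IH => // v vA; apply: hA => a; rewrite inE => /predU1P[->|/vA//].
by apply: contrapT => /eqP gv; apply: nz; exists v.
Qed.

(** A new functional that vanishes on the common kernel of [A] imposes no new condition, by
    [bidual_eval_kernel]; otherwise some [z] in that kernel corrects [p]. *)
Lemma bidual_eval A phi : is_bidual phi -> (forall g, g \in A -> is_dual g) ->
  exists p : X, forall g, g \in A -> phi g = g p.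
Proof.
move=> bphi; elim: A => [|g A IH] dA; first by exists 0.
have dA' a : a \in A -> is_dual a by move=> aA; apply: dA; rewrite inE aA orbT.
have dg : is_dual g by apply: dA; rewrite mem_head.
have [p pA] := IH dA'.
have [[z [zA gz]]|nz] := pselect (exists z, (forall a, a \in A -> a z = 0) /\ g z != 0).
  exists (p + ((phi g - g p) / g z) *: z) => a; rewrite inE => /predU1P[->|aA].
    have lg := is_dual_slin dg.
    by rewrite (slinD _ _ lg) (slinZ _ _ lg) divfK// addrC subrK.
  have la := is_dual_slin (dA' _ aA).
  by rewrite (slinD _ _ la) (slinZ _ _ la) (zA _ aA) mulr0 addr0 (pA _ aA).
exists p => a; rewrite inE => /predU1P[->|/pA//].
apply: (bidual_eval_kernel bphi dA' pA dg) => v vA.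
by apply: contrapT => /eqP gv; apply: nz; exists v.
Qed.

(** The norm may fail to be attained. The 3/4 has to exceed 1/2, since it will be multiplied by the
    factor 2 of [helly]. *)
Lemma dual_norm_attained (g : X -> R) : is_dual g -> exists c,
  [/\ 0 <= c, bounded_by c g & exists2 w : X, `|w| <= 1 & 3 / 4 * c <= g w].
Proof.
move=> dg; have gb := dual_norm_bounded_by dg; have lg := is_dual_slin dg.
have g0 : 0 <= dual_norm g.
  apply: (@le_trans _ _ `|g 0|) => //; apply: (sup_upper_bound (dual_norm_has_sup dg)).
  by exists 0 => //=; rewrite normr0.
exists (dual_norm g); split=> //.
move: g0; rewrite le_eqVlt => /predU1P[<-|g0].
  by exists 0; rewrite ?normr0// (slin0 lg) mulr0.
have e0 : 0 < dual_norm g / 4 by rewrite divr_gt0.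
have [_ [w /= w1 <-] gw] := sup_adherent e0 (dual_norm_has_sup dg).
have {}gw : 3 / 4 * dual_norm g <= `|g w|.
  by apply: le_trans (ltW gw); rewrite -/(dual_norm g); lra.
have [gw0|gw0] := leP 0 (g w); first by exists w => //; rewrite -(ger0_norm gw0).
by exists (- w); rewrite ?normrN// (slinN _ lg) -(ltr0_norm gw0).
Qed.

(* By Hahn-Banach in X^N, a failure would produce functionals g_j that
   contradict the estimates on the F's. *)
Lemma helly (n N : nat) (F : nat -> (X -> R) -> R) A (b : 'I_N -> nat -> R)
    (x : 'I_N -> X) (r : 'I_N -> R) :
  (forall l, is_bidual (F l)) -> (forall g, g \in A -> is_dual g) ->
  (forall j, 0 < r j) ->
  (forall j, bnorm (\sum_(l < n) b j l *: F l - pi (x j)) <= r j) ->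
  exists y : nat -> X, (forall l g, g \in A -> F l g = g (y l)) /\
    forall j, `|\sum_(l < n) b j l *: y l - x j| <= 2 * r j.
Proof.
move=> bF dA r0 Fx; apply: contrapT => /forallNP H.
have {}H y : (forall l g, g \in A -> F l g = g (y l)) ->
    exists j, 2 * r j < `|\sum_(l < n) b j l *: y l - x j|.
  move=> yA; have /not_andP[//|/existsNP[j /negP]] := H y.
  by rewrite -ltNge; exists j.
have /choice[p pA] l := bidual_eval (bF l) dA.
pose L (j : 'I_N) (q : nat -> X) := \sum_(l < n) b j l *: q l.
have LD j a q q' : L j (fun l => a *: q l + q' l) = a *: L j q + L j q'.
  rewrite /L scaler_sumr -big_split; apply: eq_bigr => l _ /=.
  by rewrite scalerDr !scalerA mulrC.
pose z0 (j : 'I_N) := x j - L j p.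
(* In this weighted maximum norm on X^N, a failure means that [z0] is at distance at least 1 from
   the vectors [L^~ q] with all [q l] in the common kernel of [A]. *)
pose P (z : 'I_N -> X) := \big[Num.max/0]_(j < N) (`|z j| / (2 * r j)).
have r20 j : 0 < 2 * r j by rewrite mulr_gt0.
have leP z j : `|z j| / (2 * r j) <= P z by exact: le_bigmax.
have P0 z : 0 <= P z by exact: bigmax_ge_id.
have Ple z c : 0 <= c -> (forall j, `|z j| <= c * (2 * r j)) -> P z <= c.
  by move=> c0 zc; apply: bigmax_le => // j _; rewrite ler_pdivrMr.
have leP' z j : `|z j| <= P z * (2 * r j) by rewrite -ler_pdivrMr.
have semP : seminorm_on setT P.
  split=> [u v _ _|a u _].
    apply: Ple => [|j]; first by rewrite addr_ge0.
    by rewrite (le_trans (ler_normD _ _))// mulrDl lerD.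
  have le c z : P (c *: z) <= `|c| * P z.
    apply: Ple => [|j]; first by rewrite mulr_ge0.
    by rewrite -mulrA [leLHS](normrZ c (z j)) ler_wpM2l.
  apply/eqP; rewrite eq_le le/=; have [->|a0] := eqVneq a 0.
    by rewrite normr0 mul0r.
  rewrite -ler_pdivlMl ?normr_gt0// -normfV (le_trans _ (le _ _))//.
  by rewrite scalerA mulVf// scale1r.
pose G (z : 'I_N -> X) (t : R) := exists q : nat -> X,
  (forall l g, g \in A -> g (q l) = 0) /\ z = (fun j => L j q + t *: z0 j).
have linG : linear_relation G.
  split.
    exists (fun=> 0); split=> [l g /dA/is_dual_slin/slin0//|].
    apply/funext => j; rewrite scale0r addr0 /L big1// => l _.
    by rewrite scaler0.
  move=> a u t v s [q [qA ->]] [q' [q'A ->]].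
  exists (fun l => a *: q l + q' l); split.
    move=> l g gA; have lg := is_dual_slin (dA _ gA).
    by rewrite lg qA// q'A// mulr0 addr0.
  apply/funext => j; rewrite LD [LHS]/(a *: (L j q + t *: z0 j) + (L j q' + s *: z0 j)).
  by rewrite scalerDr scalerDl scalerA addrACA.
have domG z t : G z t -> setT z /\ `|t| <= P z.
  move=> [q [qA zE]]; split=> //; have [->|t0] := eqVneq t 0; first by rewrite normr0.
  pose y l := (- t^-1) *: q l + p l.
  have yA l g : g \in A -> F l g = g (y l).
    by move=> gA; rewrite (is_dual_slin (dA _ gA)) qA// mulr0 add0r pA.
  have [j] := H y yA; rewrite -/(L j y) LD => Hj.
  apply: le_trans (leP z j); rewrite ler_pdivlMr// mulrC -ler_pdivlMr ?normr_gt0//.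
  rewrite (le_trans (ltW Hj))// mulrC -normfV -normrZ zE -[leRHS]normrN.
  by rewrite scalerDr scalerA mulVf// scale1r scaleNr opprD /z0 opprB addrA.
have subT : linear_subspace [set: 'I_N -> X] by split.
have [ps [psl [psP psG]]] := hahn_banach subT semP linG domG.
pose single (j : 'I_N) (v : X) : 'I_N -> X := fun i => if i == j then v else 0.
pose g j v := ps (single j v).
have lg j : scalar_linear (g j).
  move=> a u v; rewrite -psl//; congr ps; apply/funext => i.
  apply: (@etrans _ _ (a *: single j u i + single j v i)) => //; rewrite /single.
  by case: eqP => _; rewrite ?scaler0 ?addr0.
have dg j : is_dual (g j).
  apply/is_dualP; split=> //; exists (2 * r j)^-1; first by rewrite invr_ge0 ltW.
  move=> v; apply: le_trans (psP _ _) _ => //; apply: Ple => [|i].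
    by rewrite mulr_ge0// invr_ge0 ltW.
  rewrite /single; case: eqP => [->|_]; last first.
    by rewrite normr0 !mulr_ge0 ?invr_ge0 ?(ltW (r0 _))// ltW.
  by rewrite mulrAC mulVf ?mul1r// gt_eqF.
have lps : scalar_linear ps by move=> a u v; rewrite psl.
have psE z : ps z = \sum_j g j (z j).
  rewrite -(slin_sum _ _ (fun j => single j (z j)) lps); congr ps.
  apply/funext => i; rewrite fct_sumE (bigD1 i)//= big1 ?addr0 /single ?eqxx// => j ji.
  by rewrite eq_sym (negbTE ji).
pose h l v := \sum_j b j l * g j v.
have dh l : is_dual (h l) by exact: is_dual_sum.
(* [ps] kills the subspace, so [h l] kills the common kernel of [A] and cannot tell [F l] from
   [p l]. *)
have Fh (l : 'I_n) : F l (h l) = h l (p l).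
  apply: (bidual_eval_kernel (bF l) dA) => // [k kA|v vA]; first exact: pA.
  have : ps (fun j => b j l *: v) = 0.
    apply: psG; exists (fun l' => if l' == l :> nat then v else 0); split.
      by move=> l' k kA; case: ifP => // _; [exact: vA | exact/slin0/is_dual_slin/dA].
    apply/funext => j; rewrite scale0r addr0 /L (bigD1 l)//= eqxx big1 ?addr0//.
    by move=> l' /negbTE; rewrite -val_eqE /= => ->; rewrite scaler0.
  rewrite psE => e; rewrite -[RHS]e; apply: eq_bigr => j _.
  by rewrite (slinZ _ _ (lg j)).
have ps1 : ps z0 = 1.
  apply: psG; exists (fun=> 0); split=> [l k /dA/is_dual_slin/slin0//|].
  by apply/funext => j; rewrite scale1r /L big1 ?add0r// => l _; rewrite scaler0.
have one : 1 = - \sum_j (\sum_(l < n) b j l *: F l - pi (x j)) (g j).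
  rewrite -ps1 psE -sumrN.
  have -> : \sum_j g j (z0 j) = \sum_j g j (x j) - \sum_(l < n) h l (p l).
    rewrite /h exchange_big /= -sumrB; apply: eq_bigr => j _.
    rewrite /z0 (slinB _ _ (lg j)) /L (slin_sum _ _ _ (lg j)); congr (_ - _).
    by apply: eq_bigr => l _; rewrite (slinZ _ _ (lg j)).
  under [X in _ - X]eq_bigr => l _ do rewrite -Fh (bidual_sum _ _ (bF l) dg).
  rewrite exchange_big /= -sumrB; apply: eq_bigr => j _.
  transitivity (- ((\sum_(l < n) b j l *: F l) (g j) - pi (x j) (g j))) => //.
  by rewrite opprB fct_sumE.
have /choice[c cP] j := dual_norm_attained (dg j).
have c0 j : 0 <= c j by case: (cP j).
have /choice[w wP] j : exists w : X, `|w| <= 1 /\ 3 / 4 * c j <= g j w.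
  by have [_ _ [w w1 gw]] := cP j; exists w.
have up : 1 <= \sum_j r j * c j.
  rewrite {1}one -sumrN (le_trans (ler_norm _))// (le_trans (ler_norm_sum _ _ _))//.
  apply: ler_sum => j _; rewrite normrN; have [_ gc _] := cP j.
  have bd : is_bidual (\sum_(l < n) b j l *: F l - pi (x j)).
    apply: bidualB; apply: subspace_sum (bidual_linear X) _ => l _.
    exact: subspaceZ (bidual_linear X) (bF l).
  by rewrite (le_trans (le_bnorm bd (dg j) gc (c0 j)))// mulrC ler_wpM2r.
(* Test [ps] at almost norming vectors of the [g j], scaled by 2 r_j; the 3/2 is 2 times 3/4 and
   contradicts [up]. *)
have : 3 / 2 * \sum_j r j * c j <= 1.
  have P1 : P (fun j => (2 * r j) *: w j) <= 1.
    apply: Ple => // j; rewrite normrZ gtr0_norm// mul1r ger_pMr//.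
    by case: (wP j).
  apply: le_trans P1; apply: le_trans (psP _ Logic.I).
  apply: le_trans (ler_norm _); rewrite psE mulr_sumr; apply: ler_sum => j _.
  rewrite (slinZ _ _ (lg j)); have [_ gw] := wP j.
  have := ler_wpM2l (ltW (r20 j)) gw; lra.
by move: up; set S := \sum_j _; lra.
Qed.

End Helly.

Section LocalReflexivity.
Variables (R : realType) (X : normedModType R).
Implicit Types (phi : (X -> R) -> R).

Local Notation pi := (@Defs.canon R X).

(** The norm of the class of [phi] in the quotient X^**/X. *)
Definition dist_canon phi : R := inf [set bnorm (phi - pi x) | x in setT].

Let dist_has_inf phi : is_bidual phi -> has_inf [set bnorm (phi - pi x) | x in setT].
Proof.
move=> bphi; split; first by exists (bnorm (phi - pi 0)), 0.
by exists 0 => _ [x _ <-]; exact/bnorm_ge0/bidualB.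
Qed.

Lemma dist_canon_le phi x : is_bidual phi -> dist_canon phi <= bnorm (phi - pi x).
Proof. by move=> /dist_has_inf[_ lb]; apply: ge_inf => //; exists x. Qed.

Lemma dist_canon_approx phi e : is_bidual phi -> 0 < e ->
  exists x, bnorm (phi - pi x) < dist_canon phi + e.
Proof. by move=> /dist_has_inf hi /inf_adherent/(_ hi)[_ [x _ <-]]; exists x. Qed.

Lemma dist_canon_seminorm : seminorm_on (@is_bidual R X) dist_canon.
Proof.
have subB := @bidual_linear R X; have semB := @bnorm_seminorm R X.
split=> [phi psi bphi bpsi|a phi bphi].
  apply/ler_addgt0Pr => e e0; have e20 : 0 < e / 2 by rewrite divr_gt0.
  have [x px] := dist_canon_approx bphi e20.
  have [y py] := dist_canon_approx bpsi e20.
  have bs := subspaceD subB bphi bpsi.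
  apply: le_trans (dist_canon_le (x + y) bs) _.
  rewrite (@bnorm_eq _ _ _ ((phi - pi x) + (psi - pi y))).
    apply: le_trans (semB.1 _ _ (bidualB x bphi) (bidualB y bpsi)) _.
    by move: px py; lra.
  move=> f df; transitivity (phi f + psi f - f (x + y)) => //.
  transitivity ((phi f - f x) + (psi f - f y)) => //.
  by rewrite (slinD _ _ (is_dual_slin df)); ring.
have le b psi : is_bidual psi -> dist_canon (b *: psi) <= `|b| * dist_canon psi.
  move=> bpsi; apply/ler_addgt0Pr => e e0.
  have e10 : 0 < e / (`|b| + 1) by rewrite divr_gt0// ltr_wpDl.
  have [x px] := dist_canon_approx bpsi e10.
  apply: le_trans (dist_canon_le (b *: x) (subspaceZ b subB bpsi)) _.
  rewrite (@bnorm_eq _ _ _ (b *: (psi - pi x))).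
    rewrite semB.2; last exact: bidualB.
    rewrite (le_trans (ler_wpM2l (normr_ge0 b) (ltW px)))// mulrDr lerD2l.
    by rewrite mulrA ler_pdivrMr ?ltr_wpDl// mulrC ler_pM2l// lerDl.
  move=> f df; transitivity (b * psi f - f (b *: x)) => //.
  transitivity (b * (psi f - f x)) => //.
  by rewrite (slinZ _ _ (is_dual_slin df)); ring.
have ge0 psi : is_bidual psi -> 0 <= dist_canon psi.
  move=> bpsi; apply: lb_le_inf; first exact: (dist_has_inf bpsi).1.
  by move=> _ [x _ <-]; exact/bnorm_ge0/bidualB.
apply/eqP; rewrite eq_le le//=; have [->|a0] := eqVneq a 0.
  by rewrite normr0 mul0r; exact: ge0 (subspaceZ 0 subB bphi).
have ba := subspaceZ a subB bphi.
rewrite -ler_pdivlMl ?normr_gt0// -normfV (le_trans _ (le a^-1 _ ba))//.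
by rewrite scalerA mulVf// scale1r.
Qed.

Lemma dist_canon_ge0 phi : is_bidual phi -> 0 <= dist_canon phi.
Proof. exact: seminorm_ge0 (@bidual_linear R X) dist_canon_seminorm. Qed.

Definition comb (V : lmodType R) (n : nat) (F : nat -> V) (b : nat -> R) : V :=
  \sum_(l < n) b l *: F l.

Lemma combP (V : lmodType R) n (F : nat -> V) a b c :
  comb n F (fun l => a * b l + c l) = a *: comb n F b + comb n F c.
Proof.
rewrite /comb scaler_sumr -big_split; apply: eq_bigr => l _ /=.
by rewrite scalerDl scalerA.
Qed.

Lemma combZ (V : lmodType R) n (F : nat -> V) a b :
  comb n F (fun l => a * b l) = a *: comb n F b.
Proof. by rewrite /comb scaler_sumr; apply: eq_bigr => l _; rewrite scalerA. Qed.

Lemma bidual_combF n F b : (forall l, is_bidual (F l)) -> @is_bidual R X (comb n F b).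
Proof.
move=> bF; apply: subspace_sum (@bidual_linear R X) _ => l _.
exact: subspaceZ (@bidual_linear R X) (bF l).
Qed.

(** [helly] controls finitely many combinations, so it is applied to a 1/4-net of the unit ball for
    the distance to X. The supremum S over the whole ball then satisfies S <= 9/2 + S/4, whence the
    6. The bounds [C] make S finite and settle the combinations at distance 0; they do not affect
    the constant. *)
Lemma local_reflexivity n (F : nat -> (X -> R) -> R) (C : nat -> R)
    (A : seq (X -> R)) :
  (forall l, is_bidual (F l)) -> (forall g, g \in A -> is_dual g) ->
  (forall k, 0 <= C k) ->
  (forall b k x, (k < n)%N -> `|b k| <= C k * bnorm (comb n F b - pi x)) ->
  exists y : nat -> X, (forall l g, g \in A -> F l g = g (y l)) /\
    forall b x, bnorm (comb n (fun l => F l - pi (y l)) b) <=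
                6 * bnorm (comb n F b - pi x).
Proof.
move=> bF dA C0 CP.
have subB := @bidual_linear R X; have semB := @bnorm_seminorm R X.
have semQ := dist_canon_seminorm.
pose q b := dist_canon (comb n F b).
have bcF b : is_bidual (comb n F b) by exact: bidual_combF.
have q0 b : 0 <= q b by exact: dist_canon_ge0.
have qZ a b : q (fun l => a * b l) = `|a| * q b by rewrite /q combZ semQ.2.
have Cq b k : (k < n)%N -> `|b k| <= C k * q b.
  move=> kn; apply/ler_addgt0Pr => e e0.
  have e10 : 0 < e / (C k + 1) by rewrite divr_gt0// ltr_wpDl.
  have [x px] := dist_canon_approx (bcF b) e10.
  rewrite (le_trans (CP b k x kn))// (le_trans (ler_wpM2l (C0 k) (ltW px)))//.
  rewrite mulrDr lerD2l mulrA ler_pdivrMr ?ltr_wpDl// mulrC ler_pM2l//.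
  by rewrite lerDl.
pose s := [seq F l | l <- iota 0 n].
have sizes : size s = n by rewrite size_map size_iota.
have ss b : spanned s (comb n F b).
  apply: subspace_sum (spanned_linear s) _ => l _.
  apply: subspaceZ (spanned_linear s) _; apply: mem_spanned.
  by apply/mapP; exists (l : nat) => //; rewrite mem_iota /=.
have bs phi : phi \in s -> is_bidual phi by move=> /mapP[l _ ->].
have e0 : 0 < 4^-1 :> R by rewrite invr_gt0.
have [B [Bs BP]] := spanned_totally_bounded subB semQ 1 bs e0.
have /choice[b bP] (j : 'I_(size B)) : exists b : nat -> R, B`_j = comb n F b.
  have /spanned_coord[c ->] := Bs _ (mem_nth 0 (ltn_ord j)).
  exists c; rewrite /comb sizes; apply: eq_bigr => i _.
  by rewrite (nth_map 0%N) ?size_iota// nth_iota.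
have /choice[x xP] (j : 'I_(size B)) :
    exists x, bnorm (comb n F (b j) - pi x) < q (b j) + 4^-1.
  exact: dist_canon_approx.
have r0 (j : 'I_(size B)) : 0 < q (b j) + 4^-1 by rewrite ltr_wpDl.
have [y [yA yP]] := helly bF dA r0 (fun j => ltW (xP j)).
exists y; split=> //.
pose T := comb n (fun l => F l - pi (y l)).
have bFy l : is_bidual (F l - pi (y l)) by exact: bidualB.
have bT c : is_bidual (T c) by exact: bidual_combF.
have TE c f : is_dual f -> T c f = comb n F c f - f (\sum_(l < n) c l *: y l).
  move=> /is_dual_slin lf; rewrite /T /comb !fct_sumE (slin_sum _ _ _ lf) -sumrB.
  apply: eq_bigr => l _; rewrite (slinZ _ _ lf) -mulrBr//.
(* 3 = 1 + 2: the distance from the combination of the [F l] to [x j], and the one given by [helly]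
   from [x j] to the combination of the [y l]. *)
have net (j : 'I_(size B)) : bnorm (T (b j)) <= 3 * (q (b j) + 4^-1).
  rewrite (@bnorm_eq _ _ _ ((comb n F (b j) - pi (x j)) -
    pi (\sum_(l < n) b j l *: y l - x j))); last first.
    move=> f df; rewrite TE//; transitivity ((comb n F (b j) f - f (x j)) -
      f (\sum_(l < n) b j l *: y l - x j)) => //.
    by rewrite (slinB _ _ (is_dual_slin df)); ring.
  apply: le_trans (seminormB subB semB (bidualB _ (bcF _)) (bidual_canon _)) _.
  by rewrite bnorm_canon; have := yP j; have := xP j; lra.
pose P := \sum_(l < n) C l * bnorm (F l - pi (y l)).
have TP c : q c <= 1 -> bnorm (T c) <= P.
  move=> c1; apply: le_trans (seminorm_sum subB semB _) _.
    by move=> l _; exact: subspaceZ subB (bFy l).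
  apply: ler_sum => l _; rewrite semB.2// ler_wpM2r ?bnorm_ge0//.
  by rewrite (le_trans (Cq c l (ltn_ord l)))// ler_piMr.
pose S := [set bnorm (T c) | c in [set c | q c <= 1]].
have S0 : S !=set0.
  exists (bnorm (T (fun=> 0))), (fun=> 0) => //=.
  rewrite /q (_ : comb n F _ = 0) ?(seminorm0 subB semQ)//.
  by rewrite /comb big1// => l _; rewrite scale0r.
have hS : has_sup S by split=> //; exists P => _ [c /= c1 <-]; exact: TP.
have supS c : q c <= 1 -> bnorm (T c) <= sup S.
  by move=> c1; apply: sup_upper_bound => //; exists c.
(* Write c = b0 + d/4 with b0 in the net and q(d) <= 1. Then q(b0) <= 5/4, and 3 (5/4 + 1/4) =
   9/2. *)
have step c : q c <= 1 -> bnorm (T c) <= 9 / 2 + sup S / 4.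
  move=> c1; have [w Bw cw] := BP _ (ss c) c1.
  have jB : (index w B < size B)%N by rewrite index_mem.
  have wE : w = comb n F (b (Ordinal jB)) by rewrite -bP /= nth_index.
  set b0 := b (Ordinal jB) in wE.
  pose d l := 4 * (-1 * b0 l + c l).
  have dE : comb n F d = 4 *: (comb n F c - comb n F b0).
    by rewrite /d combZ combP scaleN1r addrC.
  have qd : q d <= 1.
    rewrite /q dE semQ.2; last exact: subspaceB subB (bcF _) (bcF _).
    by rewrite ger0_norm// -wE; move: cw; lra.
  have TdE : T d = 4 *: (T c - T b0) by rewrite /T /d combZ combP scaleN1r addrC.
  have Td := supS _ qd; rewrite TdE semB.2 in Td; last exact: subspaceB subB (bT _) (bT _).
  have Tc : bnorm (T c) <= bnorm (T b0) + bnorm (T c - T b0).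
    have := semB.1 _ _ (bT b0) (subspaceB subB (bT c) (bT b0)).
    by rewrite addrC subrK.
  have qb0 : q b0 <= 5 / 4.
    have := seminormB subB semQ (bcF c) (subspaceB subB (bcF c) (bcF b0)).
    by rewrite opprB addrC subrK -/(q b0) -wE; move: c1 cw; rewrite /q; lra.
  have := net (Ordinal jB); rewrite -/b0 => Tb0.
  by move: Td; rewrite ger0_norm// => Td; lra.
have sup6 : sup S <= 6.
  have : sup S <= 9 / 2 + sup S / 4 by apply: ge_sup => // _ [c /= c1 <-]; exact: step.
  lra.
move=> c z; apply: le_trans (_ : 6 * q c <= _); last first.
  by rewrite ler_wpM2l// dist_canon_le.
have := q0 c; rewrite le_eqVlt => /predU1P[qc|qc].
  rewrite -qc mulr0 (_ : comb _ _ _ = 0) ?(seminorm0 subB semB)//.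
  rewrite /comb big1// => l _; have := Cq c l (ltn_ord l).
  by rewrite -qc mulr0 normr_le0 => /eqP ->; rewrite scale0r.
have q1 : q (fun l => (q c)^-1 * c l) <= 1.
  by rewrite qZ gtr0_norm ?invr_gt0// mulVf// gt_eqF.
have := le_trans (supS _ q1) sup6; rewrite /T combZ semB.2; last exact: bT.
by rewrite gtr0_norm ?invr_gt0// ler_pdivrMl// mulrC.
Qed.

End LocalReflexivity.

(** * Functionals independent modulo X *)

Section FiniteCodimension.
Variables (R : realType) (V : lmodType R) (M : set V).
Hypothesis subM : linear_subspace M.

Definition linear_on (theta : V -> R) : Prop :=
  forall a u v, M u -> M v -> theta (a *: u + v) = a * theta u + theta v.

Lemma linear_onB theta u v : linear_on theta -> M u -> M v ->
  theta (u - v) = theta u - theta v.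
Proof.
by move=> lt Mu Mv; rewrite addrC -scaleN1r lt// mulN1r addrC.
Qed.

Lemma linear_onZ theta a u : linear_on theta -> M u -> theta (a *: u) = a * theta u.
Proof.
move=> lt Mu; have M0 := subM.1.
have t0 : theta 0 = 0 by have := linear_onB lt M0 M0; rewrite !subrr.
by rewrite -[a *: u]addr0 lt// t0 addr0.
Qed.

Lemma kernels_finite_codim (T : seq (V -> R)) :
  (forall theta, theta \in T -> linear_on theta) ->
  exists s : seq V, (forall v, v \in s -> M v) /\
    forall phi, M phi -> exists2 w, spanned s w &
      forall theta, theta \in T -> theta (phi - w) = 0.
Proof.
elim: T => [|t T IH] lT.
  exists [::]; split=> // phi _; exists 0 => //; exact: (spanned_linear [::]).1.
have lT' t' : t' \in T -> linear_on t' by move=> tT; apply: lT; rewrite inE tT orbT.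
have lt : linear_on t by apply: lT; rewrite mem_head.
have [s [sM sP]] := IH lT'.
have spM := spanned_sub subM sM.
have [[z [Mz zT tz]]|nz] := pselect (exists z, [/\ M z,
    forall t', t' \in T -> t' z = 0 & t z != 0]).
  exists (z :: s); split=> [v|phi Mphi].
    by rewrite inE => /predU1P[->|/sM].
  have [w sw wT] := sP _ Mphi; have Mw := spM _ sw.
  have Mpw := subspaceB subM Mphi Mw.
  pose c := t (phi - w) / t z.
  exists (c *: z + w); first by exists c, w.
  have -> : phi - (c *: z + w) = (phi - w) - c *: z by rewrite opprD addrA addrAC.
  move=> t'; rewrite inE => /predU1P[->|t'T].
    by rewrite (linear_onB lt) ?(linear_onZ _ lt)//; [rewrite divfK// subrr|exact: subspaceZ].
  rewrite (linear_onB (lT' _ t'T))//; last exact: subspaceZ.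
  by rewrite (linear_onZ _ (lT' _ t'T))// (wT _ t'T) (zT _ t'T) mulr0 subrr.
exists s; split=> // phi Mphi; have [w sw wT] := sP _ Mphi; exists w => // t'.
rewrite inE => /predU1P[->|/wT//]; apply: contrapT => /eqP tw; apply: nz.
by exists (phi - w); split=> //; exact: subspaceB subM Mphi (spM _ sw).
Qed.

End FiniteCodimension.

(** * A sequence in the bidual, uniformly independent modulo X *)

Section IndependentSequence.
Variables (R : realType) (X : completeNormedModType R).
Implicit Types (phi F : (X -> R) -> R) (theta : ((X -> R) -> R) -> R).

Local Notation pi := (@Defs.canon R X).
Local Notation bidual := (@is_bidual R X).

(** Otherwise the common kernel of [T] would lie in X, and X together with a finite-dimensional
    space would exhaust the bidual. *)
Lemma not_quasireflexive_escape (T : seq (((X -> R) -> R) -> R)) :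
  ~ quasireflexive X -> (forall theta, theta \in T -> linear_on bidual theta) ->
  exists F, [/\ bidual F, forall theta, theta \in T -> theta F = 0 &
    forall x, exists2 f, is_dual f & F f <> f x].
Proof.
move=> nqr lT; apply: contrapT => /forallNP nF; apply: nqr.
have [s [sM sP]] := kernels_finite_codim (@bidual_linear R X) lT.
exists (size s), (fun i => s`_i); split=> [i|phi bphi].
  by apply: sM; rewrite mem_nth.
have [w sw wT] := sP _ bphi.
have bw := spanned_sub (@bidual_linear R X) sM sw.
have [x xP] : exists x, forall f, is_dual f -> (phi - w) f = f x.
  apply: contrapT => /forallNP nx; apply: (nF (phi - w)).
  split=> //; first exact: subspaceB (@bidual_linear R X) bphi bw.
  by move=> x; have /existsNP[f /not_implyP[df]] := nx x; exists f.
have [c cE] := spanned_coord sw.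
exists x, (fun i => c i) => f df.
have -> : phi f = (phi - w) f + w f by rewrite -[phi in LHS](subrK w).
by rewrite xP// {1}cE fct_sumE.
Qed.

(** The embedding is isometric, so points of X approaching [F] form a Cauchy sequence; by
    completeness [F] would be evaluation at its limit. *)
Lemma canon_closed F : bidual F -> (forall x, exists2 f, is_dual f & F f <> f x) ->
  exists2 c, 0 < c & forall x, c <= bnorm (F - pi x).
Proof.
move=> bF nF; apply: contrapT => /forall2NP H.
have /choice[x xP] (n : nat) : exists x, bnorm (F - pi x) < n.+1%:R^-1.
  have [/negP|/existsNP[x /negP]] := H n.+1%:R^-1; first by rewrite invr_gt0 ltr0n.
  by rewrite -ltNge; exists x.
have xx n m : `|x n - x m| <= n.+1%:R^-1 + m.+1%:R^-1.
  rewrite -bnorm_canon (@bnorm_eq _ _ _ ((F - pi (x m)) - (F - pi (x n)))).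
    rewrite (le_trans (seminormB (@bidual_linear R X) (@bnorm_seminorm R X) _ _))//;
      try exact: bidualB.
    by rewrite addrC lerD ?ltW.
  move=> f df; transitivity ((F f - f (x m)) - (F f - f (x n))) => //.
  by rewrite /Defs.canon (slinB _ _ (is_dual_slin df)); ring.
have cx : cvgn x.
  apply/cauchy_cvgP/cauchyP => e e0.
  have e20 : 0 < e / 2 by rewrite divr_gt0.
  have /cvgrPdist_lt/(_ _ e20)[N _ NP] := @cvg_harmonic R.
  have h m : (N <= m)%N -> m.+1%:R^-1 < e / 2.
    by move=> /NP; rewrite /= sub0r normrN ger0_norm// invr_ge0.
  exists (x N), N => // n /= Nn.
  rewrite -ball_normE /= (le_lt_trans (xx _ _))//.
  by rewrite [ltRHS]splitr ltrD// h.
have [f df] := nF (lim (x @ \oo)); apply.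
have fx : f (x n) @[n --> \oo] --> f (lim (x @ \oo)).
  by apply: cvg_comp cx _; exact: df.2.
have fF : f (x n) @[n --> \oo] --> F f.
  have [B B0 fB] := is_dual_bound df.
  apply/cvgrPdist_lt => e e0.
  have e10 : 0 < e / B by rewrite divr_gt0.
  have /cvgrPdist_lt/(_ _ e10)[N _ NP] := @cvg_harmonic R.
  exists N => // n /NP /=; rewrite sub0r normrN ger0_norm ?invr_ge0// => nB.
  have := le_bnorm (bidualB (x n) bF) df fB (ltW B0).
  rewrite [X in `|X|]/(F f - f (x n)) => /le_lt_trans; apply.
  by rewrite mulrC -ltr_pdivlMr// (lt_trans (xP n)).
exact: (cvg_unique _ fF fx).
Qed.

Lemma separating_functional F : bidual F ->
  (forall x, exists2 f, is_dual f & F f <> f x) ->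
  exists theta K, [/\ linear_on bidual theta, forall x, theta (pi x) = 0,
    theta F = 1, 0 <= K & forall phi, bidual phi -> `|theta phi| <= K * bnorm phi].
Proof.
move=> bF /(canon_closed bF)[c c0 cP].
have semB := @bnorm_seminorm R X.
have iK : 0 <= c^-1 by rewrite invr_ge0 ltW.
have semK : seminorm_on bidual (fun phi => c^-1 * bnorm phi).
  split=> [u v bu bv|a u bu]; first by rewrite -mulrDr ler_wpM2l// semB.1.
  by rewrite semB.2// mulrCA.
pose G phi t := bidual phi /\ exists x, forall f, is_dual f -> phi f = t * F f + f x.
have linG : linear_relation G.
  split.
    split; first exact: (@bidual_linear R X).1.
    by exists 0 => f df; rewrite mul0r add0r (slin0 (is_dual_slin df)).
  move=> a u r v s [bu [x ux]] [bv [y vy]]; split.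
    exact: (@bidual_linear R X).2.
  exists (a *: x + y) => f df; rewrite fct_combE ux// vy// (is_dual_slin df).
  by ring.
have domG phi t : G phi t -> bidual phi /\ `|t| <= c^-1 * bnorm phi.
  move=> [bphi [x px]]; split=> //; have [->|t0] := eqVneq t 0.
    by rewrite normr0 mulr_ge0// bnorm_ge0.
  rewrite (@bnorm_eq _ _ _ (t *: (F - pi (- t^-1 *: x)))).
    rewrite semB.2; last exact: bidualB.
    by rewrite mulrCA ler_peMr// ler_pdivlMl// mulr1.
  move=> f df; transitivity (t * (F f - f (- t^-1 *: x))) => //.
  by rewrite px// (slinZ _ _ (is_dual_slin df)); field.
have [theta [tl [tK tG]]] := hahn_banach (@bidual_linear R X) semK linG domG.
exists theta, c^-1; split=> // [x|].
  by apply: tG; split; [exact: bidual_canon | exists x => f df; rewrite mul0r add0r].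
apply: tG; split=> //; exists 0 => f df.
by rewrite mul1r (slin0 (is_dual_slin df)) addr0.
Qed.

Lemma triangular_sequence : ~ quasireflexive X ->
  exists (F : nat -> (X -> R) -> R) (theta : nat -> ((X -> R) -> R) -> R) (K : nat -> R),
    [/\ forall k, bidual (F k),
        forall k, [/\ linear_on bidual (theta k), forall x, theta k (pi x) = 0,
          theta k (F k) = 1, 0 <= K k &
          forall phi, bidual phi -> `|theta k phi| <= K k * bnorm phi] &
        forall j k, (j < k)%N -> theta j (F k) = 0].
Proof.
move=> nqr.
pose good z := [/\ linear_on bidual z.1.2, forall x, z.1.2 (pi x) = 0,
  z.1.2 z.1.1 = 1, 0 <= z.2 &
  forall phi, bidual phi -> `|z.1.2 phi| <= z.2 * bnorm phi].
have /choice[S SP] (T : seq (((X -> R) -> R) -> R)) :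
    exists z : ((X -> R) -> R) * (((X -> R) -> R) -> R) * R,
    (forall theta, theta \in T -> linear_on bidual theta) ->
    [/\ bidual z.1.1, good z & forall theta, theta \in T -> theta z.1.1 = 0].
  have [lT|nT] := pselect (forall theta, theta \in T -> linear_on bidual theta).
    have [F [bF FT nF]] := not_quasireflexive_escape nqr lT.
    have [theta [K tP]] := separating_functional bF nF.
    by exists (F, theta, K) => _; split.
  by exists (fun=> 0, fun=> 0, 0).
pose L := fix L k := if k is k'.+1 then (S (L k')).1.2 :: L k' else [::].
have lL k : forall theta, theta \in L k -> linear_on bidual theta.
  elim: k => //= k IH theta; rewrite inE => /predU1P[->|/IH//].
  by have [_ [] ] := SP _ IH.
have memL j k : (j < k)%N -> (S (L j)).1.2 \in L k.
  elim: k => // k IH; rewrite ltnS leq_eqVlt => /predU1P[->|/IH jk].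
    by rewrite /= mem_head.
  by rewrite /= inE jk orbT.
exists (fun k => (S (L k)).1.1), (fun k => (S (L k)).1.2), (fun k => (S (L k)).2).
split=> [k|k|j k jk].
- by have [] := SP _ (lL k).
- by have [_ ? _] := SP _ (lL k).
- by have [_ _] := SP _ (lL k); apply; exact: memL.
Qed.

(** [theta k] kills X and every F_l with l > k, so applied to a combination it leaves b_k plus
    multiples of earlier coefficients, already bounded. Triangularity is thus what makes [C k]
    independent of the length n. *)
Lemma independent_mod_canon : ~ quasireflexive X ->
  exists (F : nat -> (X -> R) -> R) (C : nat -> R),
    [/\ forall k, bidual (F k), forall k, 0 <= C k &
      forall n b k x, (k < n)%N -> `|b k| <= C k * bnorm (comb n F b - pi x)].
Proof.
move=> /triangular_sequence[F [theta [K [bF tP tF]]]].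
suff /choice[C CP] k : exists C, 0 <= C /\ forall n b x, (k < n)%N ->
    `|b k| <= C * bnorm (comb n F b - pi x).
  exists F, C; split=> // [k|n b k x kn]; first exact: (CP k).1.
  exact: (CP k).2.
elim/ltn_ind: k => k IH.
have /choice[C CP] j : exists C, 0 <= C /\ ((j < k)%N -> forall n b x, (j < n)%N ->
    `|b j| <= C * bnorm (comb n F b - pi x)).
  have [/IH[C [C0 CP]]|kj] := ltnP j k; first by exists C; split.
  by exists 0; split.
have C0 j := (CP j).1.
have [tl tpi t1 K0 tK] := tP k.
pose D := K k + \sum_(j < k) C j * `|theta k (F j)|.
have D0 : 0 <= D by rewrite addr_ge0// sumr_ge0// => j _; rewrite mulr_ge0.
exists D; split=> // n b x kn.
set N := bnorm _; have bc : bidual (comb n F b - pi x) by exact/bidualB/bidual_combF.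
have tsum : theta k (comb n F b - pi x) = \sum_(l < n) b l * theta k (F l).
  rewrite (linear_onB tl) ?tpi ?subr0; [|exact: bidual_combF|exact: bidual_canon].
  rewrite /comb; elim: n {kn bc N} => [|m IHm].
    rewrite !big_ord0; have := linear_onZ (@bidual_linear R X) 0 tl (bF 0%N).
    by rewrite scale0r mul0r.
  rewrite !big_ord_recr /= addrC tl//; last exact: (@bidual_combF _ _ m F b bF).
  by rewrite IHm addrC.
have bk : b k = theta k (comb n F b - pi x) - \sum_(j < k) b j * theta k (F j).
  rewrite tsum -(big_mkord xpredT (fun l => b l * theta k (F l))).
  rewrite (@big_cat_nat _ _ _ k)//=; last exact: ltnW.
  rewrite big_mkord (big_ltn kn) t1 mulr1 [X in _ + (_ + X)]big1_seq.
    by rewrite addr0; ring.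
  by move=> l /andP[_]; rewrite mem_index_iota => /andP[kl _]; rewrite tF ?mulr0.
rewrite bk (le_trans (ler_normB _ _))// /D mulrDl lerD ?tK//.
rewrite (le_trans (ler_norm_sum _ _ _))// mulr_suml; apply: ler_sum => j _.
rewrite normrM mulrAC ler_wpM2r//; apply: (CP j).2 => //.
exact: ltn_trans kn.
Qed.

End IndependentSequence.

(** * Derived sets along a well-founded tree *)

Section Derived.
Variables (R : realType) (X : normedModType R).
Implicit Types (G H : set (X -> R)) (a b : cord).

Lemma wstar_derived_subset G H : G `<=` H -> wstar_derived G `<=` wstar_derived H.
Proof.
by move=> GH f [df [g [Gg gf]]]; split=> //; exists g; split=> // n; exact: GH.
Qed.

Lemma subset_wstar_derived G : (forall f, G f -> is_dual f) ->
  G `<=` wstar_derived G.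
Proof.
move=> dG f Gf; split; first exact: dG.
by exists (fun=> f); split=> // x; exact: cvg_cst.
Qed.

Lemma dual_subspace_wstar_derived G : dual_subspace G ->
  dual_subspace (wstar_derived G).
Proof.
move=> [dG [G0 Gl]]; split; first by move=> f [].
split; first exact: subset_wstar_derived.
move=> a f g [df [f' [Gf' f'f]]] [dg [g' [Gg' g'g]]].
split; first exact: is_dual_comb.
exists (fun n x => a * f' n x + g' n x); split=> [n|x]; first exact: Gl.
apply: cvgD (g'g x); exact: cvgMl_tmp (f'f x).
Qed.

Section Subspace.
Variable G : set (X -> R).
Hypothesis Gsub : dual_subspace G.

Lemma wstar_derived_ord_dual a f : wstar_derived_ord G a f -> is_dual f.
Proof. by case: a => [|a|s] //=; [exact: Gsub.1 | case | case=> n _ []]. Qed.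

Lemma wstar_derived_ord_succ a :
  wstar_derived_ord G a `<=` wstar_derived (wstar_derived_ord G a).
Proof. exact/subset_wstar_derived/wstar_derived_ord_dual. Qed.

Lemma subset_wstar_derived_ord a : G `<=` wstar_derived_ord G a.
Proof.
elim: a => [|a IH|s IH] // f /= Gf; first exact/wstar_derived_ord_succ/IH.
by exists 0%N => //; exact/wstar_derived_ord_succ/IH.
Qed.

(** The comparison is made between derived sets rather than between trees. It shows that the union
    at an [OLim] is taken over a chain, hence is a subspace. The extra derivation in the second
    alternative is what carries the induction. *)
Lemma wstar_derived_ord_comparable a b :
  wstar_derived_ord G a `<=` wstar_derived_ord G b \/
  wstar_derived (wstar_derived_ord G b) `<=` wstar_derived_ord G a.
Proof.
pose D c := wstar_derived_ord G c.
have succP c : (forall b, D c `<=` D b \/ wstar_derived (D b) `<=` D c) ->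
    forall b, wstar_derived (D c) `<=` D b \/
              wstar_derived (D b) `<=` wstar_derived (D c).
  move=> IH [|d|s].
  - by right; exact/wstar_derived_subset/subset_wstar_derived_ord.
  - have [cd|dc] := IH d; first by left; exact: wstar_derived_subset.
    by right; exact: wstar_derived_subset.
  - have [[n cn]|/forallNP sc] := pselect (exists n, D c `<=` D (s n)).
      by left; apply: subset_trans (wstar_derived_subset cn) _ => f; exists n.
    right; apply: wstar_derived_subset => f [n _] Df.
    by have [/(sc n)|] := IH (s n); last exact.
elim: a b => [|a IH|s IH] b.
- by left; exact: subset_wstar_derived_ord.
- exact: succP.
- have [sb|] := pselect (forall n, wstar_derived (D (s n)) `<=` D b).
    by left=> f [n _] /sb.
  move=> /existsNP[n nb]; right=> f bf; exists n => //.
  by have [/nb|] := succP _ (IH n) b; last exact.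
Qed.

Lemma dual_subspace_wstar_derived_ord a :
  dual_subspace (wstar_derived_ord G a).
Proof.
elim: a => [//|a IH|s IH] /=; first exact: dual_subspace_wstar_derived.
split; first by move=> f [n _ []].
split.
  by exists 0%N => //; exact: (dual_subspace_wstar_derived (IH 0%N)).2.1.
have common n m : wstar_derived (wstar_derived_ord G (s n)) `<=`
    wstar_derived (wstar_derived_ord G (s m)) \/
    wstar_derived (wstar_derived_ord G (s m)) `<=`
    wstar_derived (wstar_derived_ord G (s n)).
  have [?|mn] := wstar_derived_ord_comparable (s n) (s m).
    by left; exact: wstar_derived_subset.
  by right; apply: subset_trans mn _; exact: wstar_derived_ord_succ.
move=> c f g [n _ nf] [m _ mg].
have [nm|mn] := common n m.
- exists m => //; apply: (dual_subspace_wstar_derived (IH m)).2.2 => //.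
  exact: nm.
- exists n => //; apply: (dual_subspace_wstar_derived (IH n)).2.2 => //.
  exact: mn.
Qed.

End Subspace.

Lemma dual_subspace_sum G (I : eqType) (r : seq I) (c : I -> R)
    (f : I -> X -> R) : dual_subspace G ->
  (forall i, i \in r -> c i = 0 \/ G (f i)) -> G (fun x => \sum_(i <- r) c i * f i x).
Proof.
move=> [_ [G0 Gl]]; elim: r => [|i r IH] Gf.
  by rewrite (_ : (fun _ => _) = fun=> 0)//; apply/funext=> x; rewrite big_nil.
rewrite (_ : (fun _ => _) =
    fun x => c i * f i x + \sum_(j <- r) c j * f j x); last first.
  by apply/funext=> x; rewrite big_cons.
have {}IH : G (fun x => \sum_(j <- r) c j * f j x).
  by apply: IH => j jr; apply: Gf; rewrite inE jr orbT.
have [c0|Gi] := Gf i (mem_head _ _); last exact: Gl.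
rewrite (_ : (fun _ => _) = fun x => \sum_(j <- r) c j * f j x)//.
by apply/funext=> x; rewrite c0 mul0r add0r.
Qed.

End Derived.

Lemma sum_eqb (R : pzRingType) (F : nat -> R) a b i :
  \sum_(a <= j < b) F j * (i == j)%:R = if (a <= i < b)%N then F i else 0.
Proof.
rewrite -(big_nat1_eq +%R _ i a b) [RHS]big_mkcond; apply: eq_bigr => j _.
by rewrite eq_sym; case: eqP => _; rewrite ?mulr1 ?mulr0.
Qed.

(** * The subspace attached to a tree of vectors *)

Section Transfinite.
Variables (R : realType) (X : completeNormedModType R).
Variables (x : nat -> nat -> X) (u : nat -> nat -> X -> R) (M : nat -> R).

Definition finitely_supported : set (X -> R) :=
  [set g | is_dual g /\
    exists N, forall k i, (N <= k)%N || (N <= i)%N -> g (x k i) = 0].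

Definition psum (k m : nat) : X := \sum_(i < m.+1) x k i.

Hypothesis u_dual : forall k i, is_dual (u k i).
Hypothesis u_x : forall k i l j, u k i (x l j) = ((k == l) && (i == j))%:R.
Hypothesis u_cvg0 : forall k v, u k i v @[i --> \oo] --> (0 : R).
Hypothesis psum_le : forall k m, `|psum k m| <= M k.
Hypothesis approx : forall g : X -> R, is_dual g ->
  wstar_derived finitely_supported g.

Definition code (t : seq nat) : nat := (pickle t).+1.

Lemma code_inj : injective code.
Proof. by move=> s t [] /(pcan_inj pickleK). Qed.

Lemma M_ge0 k : 0 <= M k.
Proof. exact: le_trans (psum_le k 0). Qed.

Lemma u_psum k i l m : u k i (psum l m) = ((k == l) && (i <= m)%N)%:R.
Proof.
rewrite (slin_sum _ _ _ (is_dual_slin (u_dual _ _))).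
under eq_bigr => j _ do rewrite u_x.
rewrite -(big_mkord xpredT (fun j => ((k == l) && (i == j))%:R)).
have [_|_] /= := eqVneq k l; last by rewrite big1.
under eq_bigr => j _ do rewrite -[_%:R]mul1r.
by rewrite sum_eqb leq0n ltnS; case: (i <= m)%N.
Qed.

Lemma dual_subspace_finitely_supported : dual_subspace finitely_supported.
Proof.
split; first by move=> f [].
split; first by split; [exact: is_dual0 | exists 0%N].
move=> a f g [df [N fN]] [dg [N' gN']]; split; first exact: is_dual_comb.
exists (maxn N N') => k i; rewrite !geq_max.
by case/orP => /andP[h h']; rewrite fN ?gN' ?h ?h' ?orbT// mulr0 addr0.
Qed.

Lemma finitely_supported_u k i : finitely_supported (u k i).
Proof.
split=> //; exists (maxn k i).+1 => l j H; rewrite u_x; apply/eqP.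
rewrite pnatr_eq0 eqb0; apply/negP => /andP[/eqP kl /eqP ij].
by move: H; rewrite kl ij !gtn_max !ltnn andbF.
Qed.

(* A finite sequence [t] is a node of a well-founded tree, [m :: t] being its
   [m]-th child; [rank] walks down the Brouwer tree [alpha] along it.  The
   family attached to [t] is [x (code t)], and [x 0] is kept for the root. *)
Variables (alpha : cord) (c0 : R).
Hypothesis c0_gt0 : 0 < c0.

(* The valuation of [m.+1] at [2] takes each value for arbitrarily large [m]. *)
Fixpoint rank (t : seq nat) : option cord :=
  if t is m :: t' then
    match rank t' with
    | Some (OSucc b) => Some b
    | Some (OLim s) => Some (s (logn 2 m.+1))
    | _ => None
    end
  else Some alpha.

(** The factor 1 + M cancels the bound of the partial sums, so that the estimate at the m-th child
    is at most 1/(m+1); the summand 1 avoids dividing by M = 0. *)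
Definition coef (t : seq nat) : R :=
  if t is m :: _ then (m.+1%:R * (1 + M (code t)))^-1 else c0.

Fixpoint point (t : seq nat) : X :=
  if t is m :: t' then point t' - coef t' *: psum (code t') m else x 0 0.

(** Finite support makes g(s_m) eventually constant, so the limit in a leaf condition is expressed
    by an equality for all large m. *)
Definition Gamma : set (X -> R) :=
  [set g | finitely_supported g /\ forall t, rank t = Some OZero ->
    exists N, forall m, (N <= m)%N -> g (point t) = coef t * g (psum (code t) m)].

Lemma coef_gt0 t : 0 < coef t.
Proof.
case: t => //= m t; rewrite invr_gt0 mulr_gt0// ltr_pwDl//.
exact: M_ge0.
Qed.

Lemma point_cons f m t : is_dual f ->
  f (point (m :: t)) = f (point t) - coef t * f (psum (code t) m).
Proof.
by move=> /is_dual_slin fl; rewrite /= (slinB _ _ fl) (slinZ _ _ fl).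
Qed.

Lemma dual_subspace_Gamma : dual_subspace Gamma.
Proof.
have [_ [E0 El]] := dual_subspace_finitely_supported.
split; first by move=> f [[]].
split; first by split=> // t _; exists 0%N => m _; rewrite mulr0.
move=> a f g [Ef fP] [Eg gP]; split; first exact: El.
move=> t rt; have [N fN] := fP t rt; have [N' gN'] := gP t rt.
exists (maxn N N') => m; rewrite geq_max => /andP[Nm N'm].
by rewrite (fN m)// (gN' m)//; ring.
Qed.

Lemma logn2_unbounded n N : exists2 m, (N <= m)%N & logn 2 m.+1 = n.
Proof.
pose k := (2 ^ n * (N.*2).+1)%N.
have k0 : (0 < k)%N by rewrite muln_gt0 expn_gt0.
exists k.-1; rewrite ?prednK// /k.
  rewrite -ltnS prednK// (leq_trans _ (leq_pmull _ _)) ?expn_gt0// ltnS.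
  by rewrite -addnn leq_addr.
rewrite lognM ?expn_gt0// pfactorK// logn_coprime ?addn0//.
by rewrite coprime2n /= odd_double.
Qed.

(** * Norm estimates on the derived sets *)

Let psum_bound h k m C : 0 <= C -> bounded_by C h -> `|h (psum k m)| <= M k * C.
Proof. by move=> C0 hC; rewrite (le_trans (hC _))// mulrC ler_wpM2r. Qed.

(** Let m grow in h(X_t) = c_t h(s_m) + h(X_t - c_t s_m). The estimate is asked for arbitrarily
    large m rather than all m, because below a limit only some children have a given rank. *)
Lemma point_bound t h C K : is_dual h -> 0 <= C -> bounded_by C h -> 0 <= K ->
  (forall N, exists2 m, (N <= m)%N & `|h (point (m :: t))| <= K / m.+1%:R) ->
  `|h (point t)| <= coef t * M (code t) * C.
Proof.
move=> dh C0 hC K0 hm; apply/ler_addgt0Pr => e e0.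
have [N KN] : exists N : nat, K / e <= N%:R.
  by exists (Num.bound (K / e)); rewrite ltW// archi_boundP// divr_ge0// ltW.
have [m Nm] := hm N; rewrite point_cons// => hmK.
have -> : h (point t) = coef t * h (psum (code t) m) +
    (h (point t) - coef t * h (psum (code t) m)) by ring.
rewrite (le_trans (ler_normD _ _))// lerD//.
  rewrite normrM gtr0_norm ?coef_gt0// -mulrA ler_wpM2l ?(ltW (coef_gt0 _))//.
  exact: psum_bound.
rewrite (le_trans hmK)// ler_pdivrMr// mulrC -ler_pdivrMr//.
by rewrite (le_trans KN)// ler_nat (leq_trans Nm).
Qed.

(** [K] is a common bound of the approximating sequence, not of [h]. [P] is meant to select the
    children of rank [b]: all of them below a successor, those of the right valuation below a
    limit. *)
Lemma child_bound (P : pred nat) t b h : wstar_derived (wstar_derived_ord Gamma b) h ->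
  (forall m g C, P m -> wstar_derived_ord Gamma b g -> 0 <= C -> bounded_by C g ->
    `|g (point (m :: t))| <= coef (m :: t) * M (code (m :: t)) * C) ->
  exists2 K, 0 <= K & forall m, P m -> `|h (point (m :: t))| <= K / m.+1%:R.
Proof.
move=> [dh [g [Gg gh]]] Pb.
have dg n := wstar_derived_ord_dual dual_subspace_Gamma (Gg n).
have [C C0 gC] := pointwise_cvg_bounded dg gh.
exists C => [|m Pm]; first exact: ltW.
apply: (cvgr_to_le (cvg_norm (gh (point (m :: t))))).
apply: nearW => n; apply: le_trans (Pb m _ C Pm (Gg n) (ltW C0) (gC n)) _.
rewrite mulrC ler_wpM2l ?(ltW C0)// /coef invfM -mulrA ger_pMr ?invr_gt0//.
by rewrite ler_pdivrMl ?mulr1 ?lerDr// ltr_pwDl ?M_ge0.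
Qed.

Lemma Gamma_ord_bound a t g B : rank t = Some a ->
  wstar_derived_ord Gamma a g -> 0 <= B -> bounded_by B g ->
  `|g (point t)| <= coef t * M (code t) * B.
Proof.
elim: a t g B => [|b IH|s IH] t g B rt.
- move=> [_ /(_ t rt)[N gN]] B0 gB; rewrite (gN N)//.
  rewrite normrM gtr0_norm ?coef_gt0// -mulrA ler_wpM2l ?(ltW (coef_gt0 _))//.
  exact: psum_bound.
- move=> gb B0 gB; have [m h C _|K K0 gK] := @child_bound xpredT t b g gb.
    by apply: IH; rewrite /= rt.
  by apply: (point_bound _ B0 gB K0); [case: gb | move=> N; exists N => //; exact: gK].
- move=> [n _ gn] B0 gB.
  have [m h C /eqP mn|K K0 gK] := @child_bound (fun m => logn 2 m.+1 == n) t (s n) g gn.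
    by apply: IH; rewrite /= rt mn.
  apply: (point_bound _ B0 gB K0); first by case: gn.
  by move=> N; have [m Nm /eqP mn] := logn2_unbounded n N; exists m => //; exact: gK.
Qed.

(** * Membership in the derived sets *)

Lemma u_point_size p i t : (size t <= size p)%N -> u (code p) i (point t) = 0.
Proof.
elim: t => [_|m t IH tp]; first by rewrite /= u_x.
rewrite point_cons// IH ?(ltnW tp)// u_psum (inj_eq code_inj).
case: eqP tp => [->|_ _]; first by rewrite /= ltnn.
by rewrite mulr0 subr0.
Qed.

Lemma Gamma_off g : finitely_supported g -> g (x 0 0) = 0 ->
  (forall p m, rank p <> None -> g (psum (code p) m) = 0) -> Gamma g.
Proof.
move=> Eg g0 gs; split=> // t rt; exists 0%N => m _.
rewrite gs ?rt// mulr0; have {rt} : rank t <> None by rewrite rt.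
elim: t => [//|l t IH] rlt; have rt : rank t <> None by move: rlt => /=; case: (rank t).
by rewrite (point_cons _ _ Eg.1) IH// gs// mulr0 subr0.
Qed.

Lemma Gamma_u_off k i : (forall p, rank p <> None -> k <> code p) ->
  (k, i) <> (0, 0)%N -> Gamma (u k i).
Proof.
move=> kp ki; apply: Gamma_off; first exact: finitely_supported_u.
  by rewrite u_x; case: eqP => // k0; case: eqP => // i0; case: ki; rewrite k0 i0.
by move=> p m /kp /eqP/negbTE kpF; rewrite u_psum kpF.
Qed.

(* Moving mass inside the family of [t] violates the constraints of finitely
   many children only, and [u _ 0] in the family of such a child restores the
   constraints of its whole subtree. *)
Definition shifted (t : seq nat) (i j : nat) (v : X) : R :=
  (u (code t) i v - u (code t) j v) +
  \sum_(l <- index_iota i j) - (coef t / coef (l :: t)) * u (code (l :: t)) 0 v.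

Lemma Gamma_shifted t i j : (i <= j)%N -> Gamma (shifted t i j).
Proof.
move=> ij.
have Ed : finitely_supported (shifted t i j).
  have [dE [E0 El]] := dual_subspace_finitely_supported.
  have Es : finitely_supported (fun v : X => \sum_(l <- index_iota i j)
      - (coef t / coef (l :: t)) * u (code (l :: t)) 0 v).
    apply: dual_subspace_sum dual_subspace_finitely_supported _ => l _.
    by right; exact: finitely_supported_u.
  rewrite (_ : shifted t i j = fun v => 1 * u (code t) i v +
    (-1 * u (code t) j v + \sum_(l <- index_iota i j)
      - (coef t / coef (l :: t)) * u (code (l :: t)) 0 v)); last first.
    by apply/funext => v; rewrite /shifted mul1r mulN1r addrA.
  by apply: (El); [|apply: (El) => //]; exact: finitely_supported_u.
have dd := Ed.1.
have tp : shifted t i j (point t) = 0.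
  rewrite /shifted !u_point_size// subrr add0r big1// => l _.
  by rewrite u_point_size ?mulr0.
have psum_off p m : (p != t) -> (forall l, p != l :: t) ->
    shifted t i j (psum (code p) m) = 0.
  move=> pt plt; rewrite /shifted !u_psum !(inj_eq code_inj) eq_sym (negbTE pt) subrr.
  rewrite add0r big1// => l _.
  by rewrite u_psum (inj_eq code_inj) eq_sym (negbTE (plt l)) mulr0.
(* Zero from j on, hence compatible with the value 0 at [point t]; the children whose points are
   affected are those with index in [i, j). *)
have psum_t m : shifted t i j (psum (code t) m) = (i <= m < j)%:R.
  rewrite /shifted !u_psum eqxx /= big1 => [|l _]; last first.
    rewrite u_psum (inj_eq code_inj); case: eqP => [/(congr1 size)/esym/n_Sn//|_].
    by rewrite mulr0.
  rewrite addr0 (ltnNge m j); case: (leqP j m) => [jm|_]; last by rewrite andbT subr0.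
  by rewrite (leq_trans ij jm) subrr.
have psum_child l m : shifted t i j (psum (code (l :: t)) m) =
    - (coef t / coef (l :: t)) * (i <= l < j)%:R.
  rewrite /shifted !u_psum !(inj_eq code_inj).
  case: eqP => [/(congr1 size)/n_Sn//|_] /=; rewrite subrr add0r.
  under eq_bigr => k _ do rewrite u_psum (inj_eq code_inj) eqseq_cons eqxx andbT leq0n andbT.
  under eq_bigr => k _ do rewrite eq_sym.
  by rewrite (sum_eqb (fun k => - (coef t / coef (k :: t)))); case: ifP; rewrite ?mulr1 ?mulr0.
(* Proved for every m, since the point of a child uses its parent's equality at that child's own
   index. At an affected child both sides are - [coef t]; at every further descendant both are 0. *)
have cond p : p != t -> forall m,
    shifted t i j (point p) = coef p * shifted t i j (psum (code p) m).
  elim: p => [|l p IH] lpt m.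
    rewrite psum_off// mulr0 /= /shifted !u_x /= subrr big1 ?addr0// => l _.
    by rewrite u_x mulr0.
  rewrite point_cons//; have [->|pt] := eqVneq p t.
    rewrite tp psum_t psum_child; move: (coef_gt0 (l :: t)).
    by move: (coef _) => c /gt_eqF/negbT cl; field.
  rewrite (IH pt l) subrr psum_off ?mulr0// => k.
  by rewrite eqseq_cons (negbTE pt) andbF.
split=> // p rp; have [->|/cond pc] := eqVneq p t; last by exists 0%N.
exists j => m jm; rewrite tp psum_t ltnNge jm andbF mulr0//.
Qed.

(** The difference is [shifted] with its correction terms added back, and these involve only
    functionals of the children. *)
Lemma diff_mem (D : set (X -> R)) t i j : dual_subspace D -> Gamma `<=` D ->
  (i <= j)%N -> (forall m, D (u (code (m :: t)) 0%N)) ->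
  D (fun v => u (code t) i v - u (code t) j v).
Proof.
move=> subD GD ij Dm.
have Ds : D (fun v => \sum_(l <- index_iota i j)
    (coef t / coef (l :: t)) * u (code (l :: t)) 0%N v).
  by apply: dual_subspace_sum => // l _; right.
rewrite (_ : (fun v => _) = fun v => 1 * shifted t i j v +
  \sum_(l <- index_iota i j) (coef t / coef (l :: t)) * u (code (l :: t)) 0%N v).
  by apply: subD.2.2 => //; apply: GD; exact: Gamma_shifted.
apply/funext => v; rewrite mul1r /shifted -addrA -big_split big1 ?addr0// => l _.
by rewrite /= mulNr addNr.
Qed.

(** The children of a leaf carry no condition, so their functionals are in [Gamma] itself. Otherwise
    the child has a smaller rank b, and order b + 1 is still within a. *)
Lemma child_mem a t m : rank t = Some a ->
  (forall b p i, (a = OSucc b \/ exists s n, a = OLim s /\ b = s n) ->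
     rank p = Some b -> wstar_derived (wstar_derived_ord Gamma b) (u (code p) i)) ->
  wstar_derived_ord Gamma a (u (code (m :: t)) 0%N).
Proof.
move=> rt; case: a rt => [|b|s] rt IH.
- apply: Gamma_u_off => [p rp /code_inj pm|[]//].
  by apply: rp; rewrite -pm /= rt.
- by apply: IH; [left | rewrite /= rt].
- exists (logn 2 m.+1) => //; apply: IH; last by rewrite /= rt.
  by right; exists s, (logn 2 m.+1).
Qed.

(** u_(t,i) - u_(t,j) has order a because the functionals of the children do, and it tends weak^* to
    u_(t,i) as j grows. *)
Lemma u_mem a t i : rank t = Some a ->
  wstar_derived (wstar_derived_ord Gamma a) (u (code t) i).
Proof.
elim: a t i => [|b IH|s IH] t i rt; (split; first exact: u_dual);
  exists (fun j v => u (code t) i v - u (code t) (j + i)%N v); split.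
1,3,5: move=> j; apply: diff_mem => [|||m]; [exact/dual_subspace_wstar_derived_ord/dual_subspace_Gamma|exact/subset_wstar_derived_ord/dual_subspace_Gamma|exact: leq_addl|].
1-3: apply: child_mem => // b' p k [[]//|[s' [n [[]//]]]].
- by move=> <-; exact: IH.
- by move=> <- ->; exact: IH.
all: move=> v; rewrite -[X in _ --> X]subr0; apply: cvgB; first exact: cvg_cst.
all: by rewrite (cvg_shiftn i (fun k => u (code t) k v)).
Qed.

Let Galpha := wstar_derived_ord Gamma alpha.

(** Away from the root the rank is below [alpha], which absorbs the extra derivation of [u_mem]; the
    induction climbs from [t] to the root. *)
Lemma u_mem_proper t i a : t <> [::] -> rank t = Some a -> Galpha (u (code t) i).
Proof.
move=> t0 rt; have := u_mem i rt.
apply: (_ : wstar_derived (wstar_derived_ord Gamma a) `<=` Galpha).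
elim: t a t0 rt => // m t IH a _ /=.
case rt : (rank t) => [[|b|s]|]// [] ab.
- have sb : wstar_derived (wstar_derived_ord Gamma a) `<=`
      wstar_derived_ord Gamma (OSucc b) by rewrite ab.
  have [t0|/eqP t0] := eqVneq t [::]; first by move: rt sb; rewrite t0 => -[<-].
  apply: subset_trans sb _; apply: subset_trans (IH _ t0 rt).
  exact/wstar_derived_ord_succ/dual_subspace_Gamma.
- have sb : wstar_derived (wstar_derived_ord Gamma a) `<=`
      wstar_derived_ord Gamma (OLim s) by rewrite -ab => f; exists (logn 2 m.+1).
  have [t0|/eqP t0] := eqVneq t [::]; first by move: rt sb; rewrite t0 => -[<-].
  apply: subset_trans sb _; apply: subset_trans (IH _ t0 rt).
  exact/wstar_derived_ord_succ/dual_subspace_Gamma.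
Qed.

Let sub_alpha : dual_subspace Galpha.
Proof. exact/dual_subspace_wstar_derived_ord/dual_subspace_Gamma. Qed.

(** At the root the functional has eventual partial sum 1, and the added term gives the matching
    value c0 at [x 0 0]. For i = 0 all points below the root get the value 0, so it lies in [Gamma];
    the other i follow by differences. *)
Let root_mem i : Galpha (fun v => u (code [::]) i v + c0 * u 0 0 v).
Proof.
pose rho v := u (code [::]) 0 v + c0 * u 0 0 v.
have Grho : Gamma rho.
  have Er : finitely_supported rho.
    rewrite (_ : rho = fun v => c0 * u 0 0 v + u (code [::]) 0 v); last first.
      by apply/funext => v; rewrite addrC.
    by apply: dual_subspace_finitely_supported.2.2; exact: finitely_supported_u.
  have rs p m : rho (psum (code p) m) = (p == [::])%:R.
    by rewrite /rho !u_psum (inj_eq code_inj) mulr0 addr0 eq_sym andbT.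
  have rp p m : rho (point (m :: p)) = 0.
    elim: p m => [|l p IH] m; rewrite (point_cons _ _ Er.1) rs.
      by rewrite /rho /= !u_x /=; ring.
    by rewrite IH mulr0 subr0.
  split=> // t _; exists 0%N => m _; rewrite rs.
  by case: t => [|l t]; rewrite ?rp ?mulr0// /rho /= !u_x /=; ring.
have D i' j' : (i' <= j')%N ->
    Galpha (fun v => u (code [::]) i' v - u (code [::]) j' v).
  move=> ij; apply: diff_mem => // [|m].
    exact/subset_wstar_derived_ord/dual_subspace_Gamma.
  by apply: child_mem => // b p k _; exact: u_mem.
rewrite (_ : (fun v => _) = fun v =>
  -1 * (u (code [::]) 0%N v - u (code [::]) i v) + rho v).
  apply: sub_alpha.2.2; first exact: D.
  exact/(subset_wstar_derived_ord dual_subspace_Gamma).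
by apply/funext => v; rewrite /rho; ring.
Qed.

(** At order [alpha] only the condition of the root is left. Here h = r + h2 + h4: r takes over the
    family of the root and, thanks to the condition, also the value at [x 0 0]; h2 takes over the
    other values; h4 vanishes on every [x k i]. *)
Lemma root_condition_mem h : finitely_supported h ->
  (exists N, forall m, (N <= m)%N -> h (x 0 0) = c0 * h (psum (code [::]) m)) ->
  Galpha h.
Proof.
move=> Eh [N1 hN1]; have [dh [N2 hN2]] := Eh.
pose N := maxn N1 N2.
have hN k i : (N < k)%N || (N < i)%N -> h (x k i) = 0.
  move=> H; apply: hN2; case/orP: H => /ltnW H; apply/orP; [left|right];
  by apply: leq_trans H; exact: leq_maxr.
pose c i := h (x (code [::]) i).
pose r v := \sum_(i <- index_iota 0 N.+1) c i * (u (code [::]) i v + c0 * u 0 0 v).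
have Gr : Galpha r by apply: dual_subspace_sum => // i _; right; exact: root_mem.
pose h1 v := -1 * r v + h v.
have r00 : r (x 0 0) = h (x 0 0).
  rewrite (hN1 N) ?leq_maxl// /psum (slin_sum _ _ _ (is_dual_slin dh)).
  rewrite -(big_mkord xpredT (fun i => h (x (code [::]) i))) mulr_sumr /r.
  by apply: eq_bigr => i _; rewrite !u_x /= /c; ring.
have rx i : (i <= N)%N -> r (x (code [::]) i) = c i.
  move=> iN; rewrite /r.
  under eq_bigr => j _ do rewrite !u_x eqxx /= mulr0 addr0 eq_sym.
  by rewrite sum_eqb leq0n ltnS iN.
have rx' k i : k <> 0%N -> (k <> code [::]) \/ (N < i)%N -> r (x k i) = 0.
  move=> k0 ki; rewrite /r big1_seq// => j /andP[_]; rewrite mem_index_iota ltnS => jN.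
  rewrite !u_x; have [/esym//|_] := eqVneq 0%N k.
  rewrite mulr0 addr0; case: ki => [/eqP/negbTE|Ni]; first by rewrite eq_sym => ->; rewrite mulr0.
  by rewrite (ltn_eqF (leq_ltn_trans jN Ni)) andbF mulr0.
have r0 i : i <> 0%N -> r (x 0 i) = 0.
  move=> /eqP i0; rewrite /r big1_seq// => j _.
  by rewrite !u_x /= [0%N == i]eq_sym (negbTE i0) mulr0 addr0 mulr0.
pose S := [seq (k, i) | k <- index_iota 0 N.+1, i <- index_iota 0 N.+1].
pose h2 v := \sum_(z <- S) h1 (x z.1 z.2) * u z.1 z.2 v.
have G2 : Galpha h2.
  apply: dual_subspace_sum => // -[k i] _ /=.
  have [->|/eqP k0] := eqVneq k 0%N.
    have [->|/eqP i0] := eqVneq i 0%N.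
      by left; rewrite /h1 r00 mulN1r addNr.
    right; apply: (subset_wstar_derived_ord dual_subspace_Gamma).
    by apply: Gamma_u_off => // -[].
  have [[p [rp kp]]|/forallNP kp] := pselect (exists p, rank p <> None /\ k = code p).
    have [p0|/eqP p0] := eqVneq p [::].
      left; rewrite kp p0 /h1; have [iN|Ni] := leqP i N.
        by rewrite rx// mulN1r addNr.
      by rewrite rx' ?mulr0 ?add0r ?hN ?Ni ?orbT//; right.
    right; rewrite kp; case ra : (rank p) rp => [a|]// _.
    exact: u_mem_proper ra.
  right; apply: (subset_wstar_derived_ord dual_subspace_Gamma).
  by apply: Gamma_u_off => [p rp kp'|[]//]; apply: (kp p).
have dr : is_dual r by apply: (wstar_derived_ord_dual dual_subspace_Gamma) Gr.
have dh2 := wstar_derived_ord_dual dual_subspace_Gamma G2.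
have h2x k i : (k <= N)%N -> (i <= N)%N -> h2 (x k i) = h1 (x k i).
  move=> kN iN; rewrite /h2 big_allpairs_dep /=.
  under eq_bigr => l _.
    under eq_bigr => j _ do rewrite u_x andbC -mulnb natrM mulrA [j == i]eq_sym [l == k]eq_sym.
    rewrite -mulr_suml (sum_eqb (fun j => h1 (x l j))) leq0n ltnS iN.
    over.
  by rewrite (sum_eqb (fun l => h1 (x l i))) leq0n ltnS kN.
have h2x' k i : (N < k)%N || (N < i)%N -> h2 (x k i) = 0.
  move=> ki; rewrite /h2 big1_seq// => -[l j] /andP[_ /allpairsP[[l' j'] /= []]].
  rewrite !mem_index_iota !leq0n !ltnS /= => lN jN [-> ->]; rewrite u_x.
  have [lk|_] := eqVneq l' k; last by rewrite mulr0.
  have [ji|_] := eqVneq j' i; last by rewrite andbF mulr0.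
  by move: ki; rewrite -lk -ji !ltnNge lN jN.
have h1x k i : (N < k)%N || (N < i)%N -> h1 (x k i) = 0.
  move=> ki; rewrite /h1 (hN _ _ ki) addr0.
  have [k0|/eqP k0] := eqVneq k 0%N.
    have i0 : i <> 0%N by move=> i0; rewrite k0 i0 ltn0 in ki.
    by rewrite k0 r0// mulr0.
  have [kc|/eqP kc] := eqVneq k (code [::]); last by rewrite rx' ?mulr0//; left.
  have [iN|Ni] := leqP i N; last by rewrite rx' ?mulr0//; right.
  by rewrite kc rx// /c -kc (hN _ _ ki) mulr0.
have h3 k i : -1 * h2 (x k i) + h1 (x k i) = 0.
  have [ki|] := boolP ((N < k)%N || (N < i)%N).
    by rewrite h2x' ?h1x// mulr0 addr0.
  by rewrite negb_or -!leqNgt => /andP[kN iN]; rewrite h2x// mulN1r addNr.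
pose h4 v := -1 * h2 v + h1 v.
have dh4 : is_dual h4 by apply: is_dual_comb => //; exact: is_dual_comb.
have G4 : Galpha h4.
  apply: (subset_wstar_derived_ord dual_subspace_Gamma); apply: Gamma_off.
  - by split=> //; exists 0%N => k i _; exact: h3.
  - exact: h3.
  - move=> p m _; rewrite /psum (slin_sum _ _ _ (is_dual_slin dh4)).
    by rewrite big1// => i _; exact: h3.
rewrite (_ : h = fun v => 1 * h4 v + (1 * h2 v + r v)).
  by apply: sub_alpha.2.2 => //; exact: sub_alpha.2.2.
by apply/funext => v; rewrite /h4 /h1; ring.
Qed.

Lemma derived_Galpha : wstar_derived Galpha = [set f | is_dual f].
Proof.
apply/seteqP; split=> [f []//|f /= df]; split=> //.
have [_ [g [Eg gf]]] := approx df.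
have dg n : is_dual (g n) := (Eg n).1.
have [B B0 gB] := pointwise_cvg_bounded dg gf.
have /choice[N NP] n := (Eg n).2.
pose k := code [::].
(* The defect in the root condition: [u k n] is 1 on the partial sums from n on and 0 at [x 0 0]. It
   stays bounded in n, so the added term is weak^* null. *)
pose a n := g n (x 0 0) / c0 - g n (psum k (N n)).
exists (fun n v => a n * u k n v + g n v); split=> [n|v].
  apply: root_condition_mem.
    by apply: dual_subspace_finitely_supported.2.2 => //; exact: finitely_supported_u.
  exists (maxn (N n) n) => m; rewrite geq_max => /andP[Nm nm].
  rewrite u_x u_psum eqxx nm /= mulr0 add0r mulr1.
  have -> : g n (psum k m) = g n (psum k (N n)).
    rewrite /psum !(slin_sum _ _ _ (is_dual_slin (dg n))).
    rewrite -!(big_mkord xpredT (fun i => g n (x k i))).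
    rewrite (@big_cat_nat _ _ _ (N n).+1)//=.
    rewrite [X in _ + X]big1_seq ?addr0// => i /andP[_].
    by rewrite mem_index_iota => /andP[/ltnW Ni _]; rewrite NP// Ni orbT.
  rewrite /a subrK mulrCA divff ?mulr1// gt_eqF//.
pose K := B * `|x 0 0| / c0 + M k * B.
have aK n : `|a n| <= K.
  rewrite (le_trans (ler_normB _ _))// lerD//; last exact: psum_bound (ltW B0) (gB n).
  by rewrite normrM normfV (gtr0_norm c0_gt0) ler_pM2r ?invr_gt0//; exact: gB.
have K0 : 0 <= K := le_trans (normr_ge0 _) (aK 0%N).
rewrite -[X in _ --> X]add0r; apply: cvgD (gf v).
apply/cvgr0Pnorm_lt => e e0; near=> n.
rewrite normrM (le_lt_trans (ler_wpM2r _ (aK n)))//.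
rewrite (@le_lt_trans _ _ ((K + 1) * `|u k n v|))//.
  by rewrite ler_wpM2r// lerDl.
rewrite -ltr_pdivlMl ?ltr_wpDl//; near: n.
have e1 : 0 < (K + 1)^-1 * e by rewrite mulr_gt0// invr_gt0 ltr_wpDl.
exact: (cvgr0Pnorm_lt _).1 (u_cvg0 k v) _ e1.
Unshelve. all: by end_near. Qed.

End Transfinite.

Theorem transfinite_derived (R : realType) (X : completeNormedModType R)
    (x : nat -> nat -> X) (u : nat -> nat -> X -> R) (M : nat -> R) :
  (forall k i, is_dual (u k i)) ->
  (forall k i l j, u k i (x l j) = ((k == l) && (i == j))%:R) ->
  (forall k v, u k i v @[i --> \oo] --> (0 : R)) ->
  (forall k m, `|psum x k m| <= M k) ->
  (forall g, is_dual g -> wstar_derived (finitely_supported x) g) ->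
  forall alpha, exists G : set (X -> R),
    dual_subspace G /\
    wstar_derived_ord G alpha <> wstar_derived_ord G (OSucc alpha) /\
    wstar_derived_ord G (OSucc alpha) = [set f | is_dual f].
Proof.
move=> du ux u0 sM app alpha.
have [B B0 uB] := is_dual_bound (du 0%N 0%N).
(* With c0 = 1/(K+1), the root estimate applied to [u 0 0] would read 1 <= K/(K+1). *)
pose K := M (code [::]) * B.
have K0 : 0 <= K by rewrite mulr_ge0 ?(M_ge0 sM)// ltW.
pose c0 := (K + 1)^-1; have c0_gt0 : 0 < c0 by rewrite invr_gt0 ltr_wpDl.
have top := derived_Galpha du ux u0 sM app alpha c0_gt0.
exists (Gamma x M alpha c0); split; first exact: dual_subspace_Gamma.
split=> // E0; have E := etrans E0 top.
have Gu : wstar_derived_ord (Gamma x M alpha c0) alpha (u 0%N 0%N).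
  by rewrite E; exact: du.
have := @Gamma_ord_bound _ _ _ _ sM _ _ c0_gt0 alpha [::] _ _ erefl Gu (ltW B0) uB.
rewrite /= ux /= normr1 -mulrA -/K /c0 mulrC ler_pdivlMr ?ltr_wpDl// mul1r.
by rewrite gerDl ler10.
Qed.

(** * The biorthogonal system *)

Section Stages.
Variables (R : realType) (X : completeNormedModType R).

Local Notation pi := (@Defs.canon R X).
Local Notation bidual := (@is_bidual R X).

Variables (F : nat -> (X -> R) -> R) (C : nat -> R) (d : nat -> X).
Hypothesis F_bidual : forall k, bidual (F k).
Hypothesis C_ge0 : forall k, 0 <= C k.
Hypothesis C_le : forall n b k x, (k < n)%N ->
  `|b k| <= C k * bnorm (comb n F b - pi x).

Definition adapted (i : nat) (A : seq (X -> R)) (y : nat -> X) : Prop :=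
  (forall l g, g \in A -> F l g = g (y l)) /\
  forall b x, bnorm (comb i.+1 (fun l => F l - pi (y l)) b) <=
              6 * bnorm (comb i.+1 F b - pi x).

(** Only F_0, ..., F_(i-1) are normed at stage i, although [adapted] treats F_i too: an increment at
    stage i compares with stage i - 1, where F_i has not entered yet. *)
Definition norming (i : nat) (D : seq X) (A : seq (X -> R)) : Prop :=
  forall phi, spanned (map pi D ++ map F (iota 0 i)) phi ->
  forall K : R, (forall f, f \in A -> `|phi f| <= K) -> 0 <= K -> bnorm phi <= 2 * K.

Lemma stage_step (i : nat) (D : seq X) (A : seq (X -> R)) :
  exists z : seq (X -> R) * (nat -> X), {subset A <= z.1} /\
    ((forall g, g \in A -> dual_ball g) -> [/\ forall g, g \in z.1 -> dual_ball g,
      norming i D z.1 & adapted i z.1 z.2]).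
Proof.
have [Ab|] := pselect (forall g, g \in A -> dual_ball g); last first.
  by exists (A, fun=> 0); split.
have [|A0 [A0b A0n]] := @finite_norming R X (map pi D ++ map F (iota 0 i)).
  move=> phi; rewrite mem_cat => /orP[] /mapP[v _ ->]; last exact: F_bidual.
  exact: bidual_canon.
have A1b g : g \in A ++ A0 -> dual_ball g.
  by rewrite mem_cat => /orP[/Ab|/A0b].
have A1d g : g \in A ++ A0 -> is_dual g by move=> /A1b[].
have [y [yA yP]] := local_reflexivity F_bidual A1d C_ge0 (C_le (n := i.+1)).
exists (A ++ A0, y); split=> [g gA|_]; first by rewrite mem_cat gA.
split=> // phi sphi K phiK K0; apply: (A0n _ sphi K _ K0) => f fA0.
by apply: phiK; rewrite mem_cat fA0 orbT.
Qed.

Lemma stages : exists (D : nat -> seq X) (A : nat -> seq (X -> R)) (y : nat -> nat -> X),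
  [/\ forall i g, g \in A i -> dual_ball g,
      forall i j, (i <= j)%N -> {subset A i <= A j},
      forall i j, (i <= j)%N -> {subset D i <= D j},
      forall i, d i \in D i.+1 /\ forall l, (l <= i)%N -> y i l \in D i.+1 &
      forall i, norming i (D i) (A i) /\ adapted i (A i) (y i)].
Proof.
have /choice[S SP] (z : nat * seq X * seq (X -> R)) := stage_step z.1.1 z.1.2 z.2.
(* The second component of [st i] is the list of functionals before stage i; the [A i] returned
   below is the list after it. *)
pose st := fix st i : seq X * seq (X -> R) := if i is j.+1 then
  let z := S (j, (st j).1, (st j).2) in
  ((st j).1 ++ map z.2 (iota 0 j.+1) ++ [:: d j], z.1) else ([::], [::]).
pose z i := S (i, (st i).1, (st i).2).
have stb i : forall g, g \in (st i).2 -> dual_ball g.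
  elim: i => //= i IH; have [_ /(_ IH)[]//] := SP (i, (st i).1, (st i).2).
have stS i : (st i.+1).1 = (st i).1 ++ map (z i).2 (iota 0 i.+1) ++ [:: d i] by [].
have zP i := SP (i, (st i).1, (st i).2).
have subA i : {subset (z i).1 <= (z i.+1).1} by exact: (zP i.+1).1.
have subD i : {subset (st i).1 <= (st i.+1).1} by move=> v vD; rewrite stS mem_cat vD.
exists (fun i => (st i).1), (fun i => (z i).1), (fun i => (z i).2); split=> [i|i j|i j|i|i].
- by have [] := (zP i).2 (stb i).
- elim: j => [|j IH]; first by rewrite leqn0 => /eqP ->.
  by rewrite leq_eqVlt => /predU1P[->//|/IH ij] g /ij; exact: subA.
- elim: j => [|j IH]; first by rewrite leqn0 => /eqP ->.
  by rewrite leq_eqVlt => /predU1P[->//|/IH ij] g /ij; exact: subD.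
- split=> [|l li]; rewrite stS !mem_cat; first by rewrite mem_head !orbT.
  by rewrite map_f ?orbT// mem_iota.
- by have [] := (zP i).2 (stb i).
Qed.

Variables (D : nat -> seq X) (A : nat -> seq (X -> R)) (y : nat -> nat -> X).
Hypothesis A_ball : forall i g, g \in A i -> dual_ball g.
Hypothesis A_sub : forall i j, (i <= j)%N -> {subset A i <= A j}.
Hypothesis D_sub : forall i j, (i <= j)%N -> {subset D i <= D j}.
Hypothesis D_mem : forall i, d i \in D i.+1 /\ forall l, (l <= i)%N -> y i l \in D i.+1.
Hypothesis A_norming : forall i, norming i (D i) (A i).
Hypothesis y_adapted : forall i, adapted i (A i) (y i).

(** * Combinations of the increments and their norms *)

Definition incr (m l : nat) : X := y m l - y m.-1 l.

Definition tail (i N : nat) (b : nat -> nat -> R) : X :=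
  \sum_(i <= m < N) \sum_(l < m) b l m *: incr m l.

Lemma tailP i N a b c :
  tail i N (fun l m => a * b l m + c l m) = a *: tail i N b + tail i N c.
Proof.
rewrite /tail scaler_sumr -big_split; apply: eq_bigr => m _ /=.
exact: (combP m (incr m) a (b^~ m) (c^~ m)).
Qed.

Lemma canon_spanned (s : seq X) v : spanned s v ->
  exists2 phi, spanned (map pi s) phi & forall f, is_dual f -> phi f = f v.
Proof.
elim: s v => [v ->|e s IH _ [c [w [/IH[phi sphi phiw] ->]]]].
  by exists 0 => // f df; rewrite (slin0 (is_dual_slin df)).
exists (c *: pi e + phi); first by exists c, phi.
by move=> f df; rewrite fct_combE phiw// (is_dual_slin df).
Qed.

(* All later increments vanish on [A i], so only stage [i] contributes. *)
Lemma test_tail i N b g : (i < N)%N -> g \in A i ->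
  g (tail i N b) = comb i (fun l => F l - pi (y i.-1 l)) (b^~ i) g.
Proof.
move=> iN gA; have lg := is_dual_slin (A_ball gA).1.
have Fy m l : (i <= m)%N -> g (y m l) = F l g.
  by move=> im; rewrite ((y_adapted m).1 l g)//; exact: A_sub im _ gA.
rewrite /tail (slin_sum _ _ _ lg) big_ltn// [X in _ + X]big1_seq ?addr0 => [|m /andP[_]].
  rewrite (slin_sum _ _ _ lg) /comb fct_sumE; apply: eq_bigr => l _.
  rewrite (slinZ _ _ lg) /incr (slinB _ _ lg) Fy//.
rewrite mem_index_iota => /andP[im _]; rewrite (slin_sum _ _ _ lg) big1// => l _.
rewrite (slinZ _ _ lg) /incr (slinB _ _ lg) !Fy ?subrr ?mulr0//; last exact: ltnW.
by rewrite -ltnS (ltn_predK im).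
Qed.

(** What [A i] sees of v + tail. For v in the span of [D i] it lies in the space normed by [A i], so
    its norm is at most twice that of the vector. *)
Definition residual i v (b : nat -> nat -> R) : (X -> R) -> R :=
  pi v + comb i (fun l => F l - pi (y i.-1 l)) (b^~ i).

Lemma residual_le i N v b : (i < N)%N -> spanned (D i) v ->
  bnorm (residual i v b) <= 2 * `|v + tail i N b|.
Proof.
move=> iN sv; have [phi sphi phiv] := canon_spanned sv.
pose s := map pi (D i) ++ map F (iota 0 i).
have sub1 : {subset map pi (D i) <= s} by move=> w wD; rewrite mem_cat wD.
have sub2 : {subset map F (iota 0 i) <= s} by move=> w wD; rewrite mem_cat wD orbT.
pose psi : (X -> R) -> R := phi + comb i (fun l => F l - pi (y i.-1 l)) (b^~ i).
rewrite (@bnorm_eq _ _ _ psi); last first.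
  move=> f df; transitivity (f v + comb i (fun l => F l - pi (y i.-1 l)) (b^~ i) f) => //.
  by rewrite -phiv.
apply: A_norming => //.
  apply: subspaceD (spanned_linear s) _ _.
    by apply: spanned_sub (spanned_linear s) _ _ sphi => w /sub1; exact: mem_spanned.
  apply: subspace_sum (spanned_linear s) _ => l _; apply: subspaceZ (spanned_linear s) _; apply: subspaceB (spanned_linear s) _ _.
    by apply/mem_spanned/sub2/mapP; exists (l : nat) => //; rewrite mem_iota /=.
  apply/mem_spanned/sub1/mapP; exists (y i.-1 l) => //.
  have i0 : (0 < i)%N by exact: leq_ltn_trans (leq0n _) (ltn_ord l).
  by have := (D_mem i.-1).2 l; rewrite prednK//; apply; rewrite -ltnS prednK.
move=> f fA; have [df f1] := A_ball fA.
have -> : psi f = f (v + tail i N b).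
  rewrite (slinD _ _ (is_dual_slin df)) -phiv// (test_tail _ iN fA)//.
by have := f1 (v + tail i N b); rewrite mul1r.
Qed.

Let shift i v (b : nat -> nat -> R) : X := \sum_(l < i) b l i *: y i.-1 l - v.

(** As a combination of the F's minus a vector of X, the residual dominates the coefficients through
    [C], and the combination in it through the adaptedness of stage i - 1. *)
Lemma residualE i v b : bnorm (residual i v b) = bnorm (comb i F (b^~ i) - pi (shift i v b)).
Proof.
apply: bnorm_eq => f df; have lf := is_dual_slin df.
transitivity (f v + comb i (fun l => F l - pi (y i.-1 l)) (b^~ i) f) => //.
transitivity (comb i F (b^~ i) f - f (shift i v b)) => //.
rewrite /shift (slinB _ _ lf) (slin_sum _ _ _ lf) /comb !fct_sumE opprB addrCA -sumrB.
congr (_ + _); apply: eq_bigr => l _.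
by rewrite (slinZ _ _ lf) -mulrBr.
Qed.

(** 14 = 2 (1 + 6): v is the residual minus [c], the norm of [c] is at most 6 times that of the
    residual, and the residual costs a factor 2. *)
Lemma stage_norm_le i N v b : (i < N)%N -> spanned (D i) v ->
  `|v| <= 14 * `|v + tail i N b|.
Proof.
move=> iN sv; have subB := @bidual_linear R X; have semB := @bnorm_seminorm R X.
have rle := residual_le b iN sv.
pose c := comb i (fun l => F l - pi (y i.-1 l)) (b^~ i).
have bc : bidual c by apply: bidual_combF => l; exact: bidualB.
have cle : bnorm c <= 6 * bnorm (residual i v b).
  rewrite residualE /c; case: i {iN sv rle c bc} => [|i].
    rewrite /comb !big_ord0 (seminorm0 subB semB) mulr_ge0//.
    by apply/bnorm_ge0/bidualB; exact: subB.1.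
  exact: (y_adapted i).2.
have br : bidual (residual i v b) by apply: subspaceD subB _ bc; exact: bidual_canon.
have : bnorm (residual i v b - c) <= bnorm (residual i v b) + bnorm c.
  exact: (seminormB subB semB br bc).
rewrite /residual -/c addrK bnorm_canon => H; move: cle rle; rewrite /residual -/c; lra.
Qed.

Lemma stage_coef_le i N v b k : (k < i)%N -> (i < N)%N -> spanned (D i) v ->
  `|b k i| <= 2 * C k * `|v + tail i N b|.
Proof.
move=> ki iN sv; have := C_le (b^~ i) (shift i v b) ki; rewrite -residualE.
move=> /le_trans; apply; rewrite [2 * _]mulrC -mulrA ler_wpM2l//.
exact: residual_le.
Qed.

Definition delta (l m : nat) : nat -> nat -> R :=
  fun l' m' => ((l == l') && (m == m'))%:R.

Lemma tail_delta i N m l : (i <= m < N)%N -> (l < m)%N -> tail i N (delta l m) = incr m l.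
Proof.
move=> imN lm; rewrite /tail /delta.
transitivity (\sum_(i <= m' < N | m' == m) incr m l); last first.
  by rewrite big_nat1_eq imN.
rewrite [RHS]big_mkcond; apply: eq_bigr => m' _; rewrite [m == m']eq_sym.
have [->|_] := eqVneq m' m; last by rewrite big1// => j _; rewrite andbF scale0r.
rewrite (bigD1 (Ordinal lm))//= eqxx scale1r big1 ?addr0// => j.
rewrite -val_eqE /= => /negbTE jl.
by rewrite [l == j]eq_sym jl scale0r.
Qed.

(** [rho] prescribes values through v and b, which v + tail need not determine; the estimate makes
    the prescription consistent as well as bounded. *)
Lemma stage_extension i (K : R) (rho : X -> (nat -> nat -> R) -> R) : 0 <= K ->
  (forall a v b w c, rho (a *: v + w) (fun l m => a * b l m + c l m) =
                     a * rho v b + rho w c) ->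
  (forall v b N, (i < N)%N -> spanned (D i) v -> `|rho v b| <= K * `|v + tail i N b|) ->
  exists f, [/\ is_dual f, bounded_by K f,
    forall v, spanned (D i) v -> f v = rho v (fun _ _ => 0) &
    forall m l, (i <= m)%N -> (l < m)%N -> f (incr m l) = rho 0 (delta l m)].
Proof.
move=> K0 rhoP rhoK.
pose supp N (b : nat -> nat -> R) := forall l m, (N <= m)%N -> b l m = 0.
pose G v r := exists w b N, [/\ (i < N)%N, supp N b, spanned (D i) w &
  v = w + tail i N b /\ r = rho w b].
have tail0 N : tail i N (fun _ _ => 0) = 0.
  by rewrite /tail big1// => m _; rewrite big1// => l _; rewrite scale0r.
have rho0 : rho 0 (fun _ _ => 0) = 0.
  pose z : nat -> nat -> R := fun _ _ => 0.
  have zE : (fun l m => -1 * z l m + z l m) = z.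
    by apply/funext => l; apply/funext => m; rewrite mulr0 addr0.
  by have := rhoP (-1) 0 z 0 z; rewrite zE scaler0 addr0 -/z; lra.
have tail_widen N N' b : (i < N)%N -> supp N b -> (N <= N')%N ->
    tail i N' b = tail i N b.
  move=> iN bN NN'; rewrite /tail (@big_cat_nat _ _ _ N)//=; last exact: ltnW.
  rewrite [X in _ + X]big1_seq ?addr0// => m /andP[_].
  rewrite mem_index_iota => /andP[Nm _]; rewrite big1// => l _.
  by rewrite bN// scale0r.
have spD := spanned_linear (D i).
have linG : linear_relation G.
  split.
    by exists 0, (fun _ _ => 0), i.+1; split=> //; [exact: spD.1 | rewrite tail0 addr0].
  move=> a v r v' r' [w [b [N [iN bN sw [-> ->]]]]] [w' [b' [N' [iN' bN' sw' [-> ->]]]]].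
  exists (a *: w + w'), (fun l m => a * b l m + b' l m), (maxn N N'); split.
  - by rewrite leq_max iN.
  - move=> l m; rewrite geq_max => /andP[Nm N'm].
    by rewrite bN// bN'// mulr0 addr0.
  - exact: spD.2.
  split; last by rewrite rhoP.
  rewrite tailP (tail_widen _ _ _ iN bN (leq_maxl _ _)).
  by rewrite (tail_widen _ _ _ iN' bN' (leq_maxr _ _)) scalerDr addrACA.
have GK v r : G v r -> `|r| <= K * `|v|.
  by move=> [w [b [N [iN _ sw [-> ->]]]]]; exact: rhoK.
have [f [df fK fG]] := dual_extension K0 linG GK.
exists f; split=> // [v sv|m l im lm]; apply: fG.
  by exists v, (fun _ _ => 0), i.+1; split=> //; rewrite tail0 addr0.
exists 0, (delta l m), m.+1; split.
- exact: im.
- by move=> l' m' mm'; rewrite /delta (ltn_eqF mm') andbF.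
- exact: spD.1.
- by rewrite tail_delta ?im ?ltnSn// add0r.
Qed.

Lemma incr_spanned i m l : (l < m)%N -> (m < i)%N -> spanned (D i) (incr m l).
Proof.
move=> lm mi; have m0 : (0 < m)%N by exact: leq_ltn_trans lm.
apply: subspaceB (spanned_linear _) _ _; apply: mem_spanned.
  by apply: (D_sub mi); apply: (D_mem m).2; exact: ltnW.
apply: (D_sub (ltnW mi)); have := (D_mem m.-1).2 l; rewrite prednK//.
by apply; rewrite -ltnS prednK.
Qed.

(** Family k starts at stage k + 1, the first one after F_k has been approximated. *)
Definition biorth (k j : nat) : X := incr (k + j).+1 k.

(** It reads off the k-th coefficient at stage k + j + 1. Increments of earlier stages lie in the
    span of [D] at this stage, which it kills. *)
Lemma biorthogonal_functional k j : exists f, [/\ is_dual f, bounded_by (2 * C k) f,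
  forall v, spanned (D (k + j).+1) v -> f v = 0 &
  forall l i, f (biorth l i) = ((k == l) && (j == i))%:R].
Proof.
have ki : (k < (k + j).+1)%N by rewrite ltnS leq_addr.
have [|//|v b N iN sv|f [df fK f0 f1]] := @stage_extension (k + j).+1 (2 * C k)
    (fun _ b => b k (k + j).+1).
- by rewrite mulr_ge0.
- exact: stage_coef_le.
exists f; split=> // l i; rewrite /biorth.
have [le|lt] := leqP (k + j).+1 (l + i).+1.
  rewrite f1 ?ltnS ?leq_addr// /delta; congr (nat_of_bool _)%:R.
  rewrite [l == k]eq_sym; have [->|//] := eqVneq k l.
  by rewrite /= eqSS eqn_add2l eq_sym.
rewrite f0; last by apply: incr_spanned => //; rewrite ltnS leq_addr.
have [kl|//] := eqVneq k l; have [ji|//] := eqVneq j i.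
by rewrite kl ji ltnn in lt.
Qed.

Lemma psum_biorth k m : psum biorth k m = y (k + m).+1 k - y k k.
Proof.
rewrite /psum; elim: m => [|m IH].
  by rewrite big_ord1 /biorth /incr /= addn0.
by rewrite big_ord_recr /= IH /biorth /incr /= addnS addrC addrA subrK.
Qed.

(** 7 = 1 + 6: adaptedness for the single F_k, compared with x = 0. *)
Lemma y_le i k : (k <= i)%N -> `|y i k| <= 7 * bnorm (F k).
Proof.
move=> ki; have subB := @bidual_linear R X; have semB := @bnorm_seminorm R X.
pose b l : R := (l == k)%:R.
have bE (G : nat -> (X -> R) -> R) : comb i.+1 G b = G k.
  rewrite /comb (bigD1 (Ordinal (ki : (k < i.+1)%N)))//= /b eqxx scale1r.
  rewrite big1 ?addr0// => l; rewrite -val_eqE /= => /negbTE ->.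
  by rewrite scale0r.
have := (y_adapted i).2 b 0; rewrite !bE (@bnorm_eq _ _ (F k - pi 0) (F k)); last first.
  move=> f df; transitivity (F k f - f 0) => //.
  by rewrite (slin0 (is_dual_slin df)) subr0.
have bd := bidualB (y i k) (F_bidual k).
have := seminormB subB semB (F_bidual k) bd.
by rewrite opprB addrC subrK bnorm_canon; lra.
Qed.

Lemma psum_biorth_le k m : `|psum biorth k m| <= 14 * bnorm (F k).
Proof.
rewrite psum_biorth (le_trans (ler_normB _ _))//.
have k1 : (k <= (k + m).+1)%N by rewrite leqW// leq_addr.
by have := y_le k1; have := y_le (leqnn k); lra.
Qed.

Hypothesis d_dense : dense (range d).

Lemma d_spanned n i : (n < i)%N -> spanned (D i) (d n).
Proof. by move=> ni; apply: mem_spanned; apply: (D_sub ni); exact: (D_mem n).1. Qed.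

(** Prescribe g on the span of [D i] and 0 on all increments from stage i on. By [stage_norm_le]
    this costs a factor 14 for every i, and each d_n is eventually in [D i]. *)
Lemma biorth_approx (g : X -> R) : is_dual g ->
  wstar_derived (finitely_supported biorth) g.
Proof.
move=> dg; split=> //; have [B B0 gB] := is_dual_bound dg; have lg := is_dual_slin dg.
have K0 : 0 <= B * 14 by rewrite mulr_ge0// ltW.
have /choice[h hP] i : exists f, [/\ is_dual f, bounded_by (B * 14) f,
    forall v, spanned (D i) v -> f v = g v &
    forall m l, (i <= m)%N -> (l < m)%N -> f (incr m l) = 0].
  have [||f [df fK f0 f1]] := @stage_extension i (B * 14) (fun v _ => g v) K0.
  - by move=> a v b w c; exact: lg.
  - move=> v b N iN sv; rewrite (le_trans (gB v))// -mulrA ler_wpM2l ?(ltW B0)//.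
    exact: stage_norm_le.
  by exists f; split=> // m l im lm; rewrite f1// (slin0 lg).
exists h; split=> [i|].
  have [dh _ _ h1] := hP i; split=> //; exists i => k j ij.
  apply: h1; last by rewrite ltnS leq_addr.
  apply: leqW; case/orP: ij => /leq_trans; apply; [exact: leq_addr|exact: leq_addl].
apply: (bounded_dense_cvg d_dense K0) => // [n|n|_ [n _ <-]].
- by have [] := hP n.
- by have [] := hP n.
- exists n.+1 => // i /= ni; have [_ _ h0 _] := hP i.
  by apply: h0; exact: d_spanned.
Qed.

Lemma biorthogonal_system : exists (x : nat -> nat -> X) (u : nat -> nat -> X -> R)
    (M : nat -> R),
  [/\ forall k i, is_dual (u k i),
      forall k i l j, u k i (x l j) = ((k == l) && (i == j))%:R,
      forall k v, u k i v @[i --> \oo] --> (0 : R),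
      forall k m, `|psum x k m| <= M k &
      forall g, is_dual g -> wstar_derived (finitely_supported x) g].
Proof.
have /choice[u uP] (z : nat * nat) := biorthogonal_functional z.1 z.2.
exists biorth, (fun k j => u (k, j)), (fun k => 14 * bnorm (F k)); split.
- by move=> k i; have [] := uP (k, i).
- by move=> k i l j; have [_ _ _] := uP (k, i); apply.
(* The bound does not depend on the second index, and d_n lies in [D (k + i).+1], on which
   [u (k, i)] vanishes, as soon as i >= n. *)
- move=> k; have K0 : 0 <= 2 * C k by rewrite mulr_ge0.
  apply: (bounded_dense_cvg d_dense K0) => [n||n|_ [n _ <-]].
  + by have [] := uP (k, n).
  + exact: is_dual0.
  + by have [] := uP (k, n).
  + exists n => // i /= ni; have [_ _ u0 _] := uP (k, i).
    by apply: u0; apply: d_spanned; rewrite ltnS (leq_trans ni)// leq_addl.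
- exact: psum_biorth_le.
- exact: biorth_approx.
Qed.

End Stages.

Theorem mainTheorem1 (R : realType) (X : completeNormedModType R) :
  separable X -> ~ quasireflexive X ->
  forall alpha : cord,
    exists G : set (X -> R),
      dual_subspace G /\
      wstar_derived_ord G alpha <> wstar_derived_ord G (OSucc alpha) /\
      wstar_derived_ord G (OSucc alpha) = [set f | is_dual f].
Proof.
move=> [d d_dense] /independent_mod_canon[F [C [bF C0 CP]]].
have [D [A [y [Ab Asub Dsub Dmem An]]]] := stages d bF C0 CP.
have [x [u [M [du ux u0 sM app]]]] :=
  biorthogonal_system bF C0 CP Ab Asub Dsub Dmem
    (fun i => (An i).1) (fun i => (An i).2) d_dense.
exact: transfinite_derived du ux u0 sM app.
Qed.
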